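(* Let $n\ge 2$ and $1<p<2$. Then $$\liminf_{\delta\to 0^+}\frac{\mathtt{d}_p(\delta)-1}{\delta^{\frac{p}{n-1+p}}}\ \ge\ \frac{(n-1+p)^{\frac{p}{n-1+p}}}{p}\left(\frac{|B_p^n|_n}{|B_p^{n-1}|_{n-1}}\right)^{\frac{p}{n-1+p}}.$$
   Context: $|\cdot|_k$ denotes $k$-dimensional volume; $B_p^{m}=\{x\in\mathbb{R}^m:\sum_i|x_i|^p\le 1\}$. The polar of $K$ is $K^\circ=\{y:\langle x,y\rangle\le 1\ \forall x\in K\}$. Floating body of a convex body $K\subset\mathbb{R}^n$: for $\delta\ge 0$, $K_\delta=\bigcap\{H^+ : |K\cap H^-|_n\le\delta|K|_n\}$, where $H$ ranges over hyperplanes and $H^+,H^-$ are the two corresponding closed halfspaces (in either labelling). Illumination body: for $\delta\ge 0$, $K^\delta=\{x\in\mathbb{R}^n: |\mathrm{conv}[K,x]|_n\le(1+\delta)|K|_n\}$, where $\mathrm{conv}[K,x]$ is the convex hull of $K\cup\{x\}$. For a centrally symmetric convex body $C$ put $\langle C\rangle^{\delta}=\left([C^\circ]^{\delta}\right)^\circ$. Distance of centrally symmetric convex bodies: $\mathtt{d}(C_1,C_2)=\inf\{a\ge 1:\frac1a C_1\subseteq C_2\subseteq aC_1\}$. For $0<\delta<\frac12$ put $\mathtt{d}_C(\delta)=\inf_{\delta'>0}\mathtt{d}\left(C_\delta,\langle C\rangle^{\delta'}\right)$ and $\mathtt{d}_p(\delta)=\mathtt{d}_{B_p^n}(\delta)$.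 *)

(* Defs.v *)
From HB Require Import structures.
From mathcomp Require Import all_boot all_order all_algebra.
From mathcomp Require Import all_classical all_reals all_analysis.

Set Implicit Arguments.
Unset Strict Implicit.
Unset Printing Implicit Defensive.

Import Order.TTheory GRing.Theory Num.Theory.
Import numFieldNormedType.Exports.

Local Open Scope classical_set_scope.
Local Open Scope ring_scope.

(* The n-fold product of the one-dimensional Lebesgue measure, on the product
   sigma-algebra of n-tuples of reals. *)
Fixpoint lebesgue_tuple (R : realType) (n : nat) :
    set (n.-tuple (measurableTypeR R)) -> \bar R :=
  match n with
  | 0 => dirac [tuple]
  | n'.+1 => pushforward (lebesgue_measure \x @lebesgue_tuple R n')%E
               (fun xt => [tuple of xt.1 :: xt.2])
  end.

Section lebesgue_tuple_step.
Context (R : realType) (n : nat).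
Local Notation RT := (measurableTypeR R).
Variable mu : {sigma_finite_measure set (n.-tuple RT) -> \bar R}.

Let tcons (xt : RT * n.-tuple RT) : n.+1.-tuple RT := [tuple of xt.1 :: xt.2].

Let measurable_tcons : measurable_fun setT tcons.
Proof. exact: measurable_cons. Qed.

Let step := pushforward (lebesgue_measure \x mu)%E tcons.

Let step0 : step set0 = 0%E. Proof. exact: measure0. Qed.

Let step_ge0 A : (0 <= step A)%E. Proof. exact: measure_ge0. Qed.

Let step_sigma_additive : semi_sigma_additive step.
Proof. exact: measure_semi_sigma_additive. Qed.

HB.instance Definition _ :=
  isMeasure.Build _ _ _ step step0 step_ge0 step_sigma_additive.

Let step_sigma_finite : sigma_finite setT step.
Proof.
have /sigma_finiteP[F [TF ndF Foo]] := sigma_finiteT (@lebesgue_measure R).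
have /sigma_finiteP[G [TG ndG Goo]] := sigma_finiteT mu.
pose g (t : n.+1.-tuple RT) : RT * n.-tuple RT :=
  (thead t, [tuple of behead t]).
have mg : measurable_fun setT g.
  apply: measurable_fun_pair; first exact: measurable_tnth.
  exact: measurable_behead.
have gK xt : g (tcons xt) = xt.
  by case: xt => x t; rewrite /g /tcons theadE; congr pair; exact: val_inj.
exists (fun i => g @^-1` (F i `*` G i)).
  apply/esym; rewrite -subTset => t _.
  have [i _ Fi] : (\bigcup_i F i) (g t).1 by rewrite -TF.
  have [j _ Gj] : (\bigcup_i G i) (g t).2 by rewrite -TG.
  exists (maxn i j) => //; split => /=.
    by move: Fi; exact/subsetPset/ndF/leq_maxl.
  by move: Gj; exact/subsetPset/ndG/leq_maxr.
move=> i; have [mF Fi] := Foo i; have [mG Gi] := Goo i; split.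
  by rewrite -[X in measurable X]setTI; apply: mg => //; exact: measurableX.
rewrite /step /pushforward -comp_preimage (_ : g \o _ = id); last exact/funext.
by rewrite product_measure1E// lte_mul_pinfty// ge0_fin_numE.
Qed.

HB.instance Definition _ :=
  Measure_isSigmaFinite.Build _ _ _ step step_sigma_finite.

Definition lebesgue_tuple_step :
  {sigma_finite_measure set (n.+1.-tuple RT) -> \bar R} := step.

End lebesgue_tuple_step.

Section lebesgue_tuple_measure.
Context (R : realType).
Local Notation RT := (measurableTypeR R).

Let bundled n :
  {mu : {sigma_finite_measure set (n.-tuple RT) -> \bar R} |
    @lebesgue_tuple R n = mu}.
Proof.
elim: n => [|n [mu muE]] /=; last first.
  by exists (lebesgue_tuple_step mu); rewrite muE.
by exists (@dirac _ (0.-tuple RT) [tuple] R).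
Qed.

Let lebesgue_tuple0 n : @lebesgue_tuple R n set0 = 0%E.
Proof. by have [mu ->] := bundled n; exact: measure0. Qed.

Let lebesgue_tuple_ge0 n A : (0 <= @lebesgue_tuple R n A)%E.
Proof. by have [mu ->] := bundled n; exact: measure_ge0. Qed.

Let lebesgue_tuple_sigma_additive n :
  semi_sigma_additive (@lebesgue_tuple R n).
Proof. by have [mu ->] := bundled n; exact: measure_semi_sigma_additive. Qed.

HB.instance Definition _ n := isMeasure.Build _ _ _ (@lebesgue_tuple R n)
  (lebesgue_tuple0 n) (@lebesgue_tuple_ge0 n)
  (@lebesgue_tuple_sigma_additive n).

Let lebesgue_tuple_sigma_finite n :
  sigma_finite setT (@lebesgue_tuple R n).
Proof. by have [mu ->] := bundled n; exact: sigma_finiteT. Qed.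

HB.instance Definition _ n := Measure_isSigmaFinite.Build _ _ _
  (@lebesgue_tuple R n) (@lebesgue_tuple_sigma_finite n).

Lemma measurable_tuple_box n (B : 'I_n -> set RT) :
  (forall i, measurable (B i)) ->
  measurable [set t : n.-tuple RT | forall i, B i (tnth t i)].
Proof.
move=> mB; rewrite (_ : mkset _ =
    \bigcap_(i in [set: 'I_n]) ((fun t : n.-tuple RT => tnth t i) @^-1` B i)).
  apply: fin_bigcap_measurable => // i _.
  by rewrite -[X in measurable X]setTI; exact: measurable_tnth.
by apply/seteqP; split => [t Bt i _|t Bt i]; exact: Bt.
Qed.

Lemma lebesgue_tuple_box n (B : 'I_n -> set RT) :
  (forall i, measurable (B i)) ->
  lebesgue_tuple [set t : n.-tuple RT | forall i, B i (tnth t i)] =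
  (\prod_(i < n) lebesgue_measure (B i))%E.
Proof.
elim: n B => [|n IHn] B mB.
  rewrite big_ord0 /= diracE mem_set//; by case.
rewrite big_ord_recl -(IHn (fun i => B (lift ord0 i)))//.
have mB' : measurable [set t : n.-tuple RT |
    forall i, B (lift ord0 i) (tnth t i)].
  exact: (@measurable_tuple_box n (fun i => B (lift ord0 i))).
rewrite -(product_measure1E _ _ (mB ord0) mB').
rewrite /= /pushforward; congr ((lebesgue_measure \x _)%E _).
apply/seteqP; split=> -[x t] /= H.
  split=> [|i]; first by have := H ord0; rewrite tnth0.
  by have := H (lift ord0 i); rewrite tnthS.
case: H => Bx Bt i; case: (unliftP ord0 i) => [j ->|->].
  by rewrite tnthS.
by rewrite tnth0.
Qed.

End lebesgue_tuple_measure.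

Section convex_bodies.
Context (R : realType).

Definition vol (k : nat) (A : set 'rV[R]_k) : \bar R :=
  lebesgue_tuple [set t : k.-tuple (measurableTypeR R) |
                   A (\row_(i < k) tnth t i)].

Lemma vol_box (k : nat) (B : 'I_k -> set (measurableTypeR R)) :
  (forall i, measurable (B i)) ->
  vol [set x : 'rV[R]_k | forall i, B i (x 0 i)] =
  (\prod_(i < k) lebesgue_measure (B i))%E.
Proof.
move=> mB; rewrite -lebesgue_tuple_box//; congr lebesgue_tuple.
by apply/seteqP; split => t /= Bt i; have := Bt i; rewrite mxE.
Qed.

Definition dotmul (n : nat) (x y : 'rV[R]_n) : R := \sum_(i < n) x 0 i * y 0 i.

Definition lp_ball (p : R) (m : nat) : set 'rV[R]_m :=
  [set x | \sum_(i < m) `|x 0 i| `^ p <= 1].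

Definition polar (n : nat) (K : set 'rV[R]_n) : set 'rV[R]_n :=
  [set y | forall x, K x -> dotmul x y <= 1].

Definition conv_hull (n : nat) (A : set 'rV[R]_n) : set 'rV[R]_n :=
  smallest (@convex_set R 'rV[R]_n) A.

(* Every closed halfspace is {y | <u, y> <= b} with u != 0, the opposite
   halfspace being {y | b <= <u, y>}; replacing (u, b) by (-u, -b) exchanges
   the two, so both labellings are covered. *)
Definition floating_body (n : nat) (K : set 'rV[R]_n) (delta : R) :
    set 'rV[R]_n :=
  [set x | forall (u : 'rV[R]_n) (b : R), u != 0 ->
     (vol (K `&` [set y | (b <= dotmul u y)%R]) <= delta%:E * vol K)%E ->
     dotmul u x <= b].

Definition illumination_body (n : nat) (K : set 'rV[R]_n) (delta : R) :
    set 'rV[R]_n :=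
  [set x | (vol (conv_hull (K `|` [set x])) <= (1 + delta)%:E * vol K)%E].

Definition polar_illumination_body (n : nat) (C : set 'rV[R]_n) (delta : R) :
    set 'rV[R]_n :=
  polar (illumination_body (polar C) delta).

Definition dilate (n : nat) (a : R) (C : set 'rV[R]_n) : set 'rV[R]_n :=
  [set a *: x | x in C].

(* Valued in the extended reals, so that an infimum over the empty set is +oo
   and not a junk real. *)
Definition body_dist (n : nat) (C1 C2 : set 'rV[R]_n) : \bar R :=
  ereal_inf [set a%:E | a in [set a : R |
    [/\ 1 <= a, dilate a^-1 C1 `<=` C2 & C2 `<=` dilate a C1]]].

(* Only the values at 0 < delta < 1/2 are meaningful. *)
Definition float_illum_dist (n : nat) (C : set 'rV[R]_n) (delta : R) : \bar R :=
  ereal_inf [set body_dist (floating_body C delta)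
                           (polar_illumination_body C delta') |
             delta' in [set delta' : R | 0 < delta']].

End convex_bodies.

Arguments lp_ball {R} p m.

(* Main.v *)
Require Import Defs.
From mathcomp Require Import all_boot all_order all_algebra.
From mathcomp Require Import all_classical all_reals all_analysis.
From mathcomp Require Import measurable_realfun ring lra.

Import Order.TTheory GRing.Theory Num.Theory.
Import numFieldNormedType.Exports.

Local Open Scope classical_set_scope.
Local Open Scope ring_scope.

(* Write n = m + 1, C = B_p^n, K = polar C = B_q^n, D = polar (K^delta'), and
   let t be the depth of the cap {x_1 >= 1 - t} of C for which the Bernoulli
   bound 1 - (1 - s)^p <= p s gives volume at most delta |C|; then
   t = c delta^alpha with c the constant of the theorem, and C_delta lies in
   {x_1 <= 1 - t}.  Near the diagonal, on the other hand, the boundary of C has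
   positive curvature, so C_delta contains (1 - t) v for the diagonal boundary
   point v as soon as delta |C| is at most a constant times t^((m+2)/2), which
   holds for small t since p < 2.  Let u be the dual diagonal point of K.
   - If delta' is at least a constant times t^((m+2)/2), then (1 + 3t) u lies in
     K^delta', and C_delta <= a D forces a >= (1 - t)(1 + 3t).
   - Otherwise every point of K^delta' has y_1 <= 1 + eps t: at the vertex the
     boundary of K is flat of order q > 2, so going out by eps t costs a volume
     of order t^(1+m/q).  Then e_1 / (1 + eps t) lies in D <= a C_delta, so that
     1 <= a (1 - t)(1 + eps t). *)

#[local] Arguments lebesgue_tuple : simpl never.

(** * Slicing the Lebesgue measure on tuples *)

Section lebesgue_tuple_theory.
Context {R : realType}.
Local Notation RT := (measurableTypeR R).

(* Valid without any measurability: the integral of a nonnegative function is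
   a supremum over the simple functions below it. *)
Lemma le_integral_setT d (T : measurableType d)
    (mu : {measure set T -> \bar R}) (f g : T -> \bar R) :
  (forall x, 0 <= f x)%E -> (forall x, f x <= g x)%E ->
  (\int[mu]_x f x <= \int[mu]_x g x)%E.
Proof.
move=> f0 fg.
have g0 x : (0 <= g x)%E by exact: le_trans (fg x).
rewrite !ge0_integralTE//; apply: ereal_sup_le => _ [h hf <-].
by exists h => // x; exact: le_trans (fg x).
Qed.

(** The product measure is by construction the integral of the measures of sections, so slicing is
    available for every set [A]. *)
Lemma lebesgue_tuple_consE n (A : set (n.+1.-tuple RT)) :
  lebesgue_tuple A =
  (\int[@lebesgue_measure R]_x
    lebesgue_tuple [set t : n.-tuple RT | A [tuple of (x : RT) :: t]])%E.
Proof.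
rewrite [LHS]/lebesgue_tuple -/lebesgue_tuple /pushforward /product_measure1;
  apply: eq_integral => x _ /=.
congr lebesgue_tuple; apply/seteqP; split=> t; rewrite /xsection/= inE => H;
  exact: H.
Qed.

(** Induction through the slicing formula covers arbitrary sets, in particular the convex hulls in
    illumination bodies. *)
Lemma le_lebesgue_tuple n (A B : set (n.-tuple RT)) : A `<=` B ->
  (lebesgue_tuple A <= lebesgue_tuple B)%E.
Proof.
elim: n A B => [|n IHn] A B AB.
  rewrite /lebesgue_tuple !diracE lee_fin ler_nat.
  by case: (boolP ([tuple] \in A)) => // /set_mem/AB/mem_set ->.
rewrite !lebesgue_tuple_consE; apply: le_integral_setT => x.
  exact: measure_ge0.
by apply: IHn => t /AB.
Qed.

Lemma lebesgue_tuple_cst_sections n (A : set (n.+1.-tuple RT)) (I : set RT)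
    (c : \bar R) : measurable I ->
  (forall x, I x -> lebesgue_tuple [set t : n.-tuple RT | A [tuple of x :: t]]
                    = c) ->
  (forall (x : RT) (t : n.-tuple RT), A [tuple of x :: t] -> I x) ->
  lebesgue_tuple A = (c * lebesgue_measure I)%E.
Proof.
move=> mI AI AsubI; rewrite lebesgue_tuple_consE -integral_cst//.
rewrite [RHS]integral_mkcond; apply: eq_integral => x _.
rewrite patchE; case: ifPn => [/set_mem/AI//|/negP nIx].
rewrite (_ : mkset _ = set0) ?measure0//.
by apply/seteqP; split=> t //= /AsubI Ix; apply: nIx; exact: mem_set.
Qed.

Lemma sum_tnth_cons n (x : RT) (t : n.-tuple RT) :
  \sum_i (tnth [tuple of x :: t] i : R) = (x : R) + \sum_i (tnth t i : R).
Proof.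
by rewrite big_ord_recl tnth0; congr +%R; apply: eq_bigr => i _; rewrite tnthS.
Qed.

(** Replacing the last coordinate by the sum of all is a shear of determinant 1. Slicing at a first
    coordinate [x] leaves a box of the same form with [b] moved to [b - x], so all sections have
    equal measure. *)
Lemma lebesgue_tuple_shear m (a : 'I_m -> R) (r b h : R) : 0 <= r -> 0 <= h ->
  lebesgue_tuple [set t : m.+1.-tuple RT |
    (forall i : 'I_m, a i <= tnth t (widen_ord (leqnSn m) i) <= a i + r) /\
    b <= \sum_i tnth t i <= b + h] = (r ^+ m * h)%:E.
Proof.
move=> r0 h0; elim: m a b => [|m IHm] a b.
  rewrite (@lebesgue_tuple_cst_sections _ _ `[b, b + h] 1)//.
  - by rewrite lebesgue_measure_itv/= lte_fin; case: ltP => bh;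
    rewrite ?mul1e ?mule0 expr0 mul1r -?EFinB; congr EFin; lra.
  - move=> x; rewrite /= in_itv/= => xb.
    rewrite /lebesgue_tuple diracE mem_set//= big_ord1 tnth0; split=> // -[]//.
  - by move=> x t /=; rewrite in_itv/= big_ord1 tnth0 => -[].
have wl (i : 'I_m) : widen_ord (leqnSn m.+1) (lift ord0 i) =
    lift ord0 (widen_ord (leqnSn m) i) by exact: val_inj.
have w0 : widen_ord (leqnSn m.+1) ord0 = ord0 by exact: val_inj.
rewrite (@lebesgue_tuple_cst_sections _ _ `[a ord0, a ord0 + r]
  (r ^+ m * h)%:E)//.
- rewrite lebesgue_measure_itv/= lte_fin.
  case: ltP => bh; rewrite ?mule0 -?EFinB -?EFinM; congr EFin.
    by rewrite exprS; ring.
  have -> : r = 0 by lra.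
  by rewrite exprS !mul0r.
- move=> x xI; have xb : a ord0 <= x <= a ord0 + r by move: xI;
  rewrite /= in_itv.
  rewrite -(IHm (fun i => a (lift ord0 i)) (b - x)).
  congr lebesgue_tuple; apply/seteqP; split=> t /= [ta tb]; split.
  - move=> i; have := ta (lift ord0 i).
    by rewrite wl tnthS.
  - by move: tb; rewrite sum_tnth_cons => /andP[? ?]; apply/andP; split; lra.
  - move=> i; case: (unliftP ord0 i) => [j|] ->.
      by rewrite wl tnthS.
    by rewrite w0 tnth0.
  - by move: tb; rewrite sum_tnth_cons => /andP[? ?]; apply/andP; split; lra.
- move=> x t /= [/(_ ord0)]; rewrite in_itv/=.
  by rewrite w0 tnth0.
Qed.

End lebesgue_tuple_theory.

(** * Scaling of the Lebesgue measure *)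

Lemma pushforward_measureP d1 d2 (T1 : measurableType d1)
    (T2 : measurableType d2) (R : realType) (m : {measure set T1 -> \bar R})
    (f : T1 -> T2) : measurable_fun setT f ->
  exists nu : {measure set T2 -> \bar R},
    nu = pushforward m f :> (set T2 -> \bar R).
Proof.
by move=> mf; exists
  (measure_function_pushforward__canonical__measure_function_Measure m mf).
Qed.

Section lebesgue_tuple_scale.
Context {R : realType}.
Local Notation RT := (measurableTypeR R).

Let measurable_scale (r : R) : measurable_fun setT (fun x : RT => r * x : RT).
Proof. exact: mulrl_measurable. Qed.

(** [r] times the pushforward along multiplication by [r] agrees with Lebesgue measure on the
    intervals []a, b]], and uniqueness extends this to measurable sets. *)
Lemma lebesgue_measure_scale (r : R) (A : set RT) : 0 < r -> measurable A ->
  lebesgue_measure ((fun x : RT => r * x : RT) @^-1` A) =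
  (r^-1%:E * lebesgue_measure A)%E.
Proof.
move=> r0 mA.
pose rn : {nonneg R} := NngNum (ltW r0).
have mr := measurable_scale r.
have [nu nuE] := pushforward_measureP _ _ _ _ _ lebesgue_measure _ mr.
pose mu : {measure set RT -> \bar R} := mscale rn nu.
rewrite (@lebesgue_measure_unique R mu _ A mA)//.
  rewrite /mu/= /mscale/= nuE /pushforward muleA -EFinM mulVf ?gt_eqF// mul1e//.
move=> _ [[a b]] _ <-.
rewrite /mu/= /mscale/= nuE /pushforward.
rewrite (_ : _ @^-1` _ = `]a / r, b / r]%classic); last first.
  apply/seteqP; split=> x /=; rewrite !in_itv/= ltr_pdivrMr// ler_pdivlMr//.
    by rewrite !(mulrC r).
  by rewrite !(mulrC r).
rewrite [in LHS]lebesgue_measure_itv [X in (_ * X)%E]lebesgue_measure_itv/=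
  !lte_fin ltr_pM2r ?invr_gt0//.
case: ifPn => ab; rewrite ?mule0// -!EFinB -EFinM; congr EFin.
by field; rewrite gt_eqF.
Qed.

Let scale_tuple n (r : R) (t : n.-tuple RT) : n.-tuple RT :=
  [tuple of map (fun x : RT => r * x : RT) t].

Let measurable_scale_tuple n (r : R) :
  measurable_fun setT (@scale_tuple n r).
Proof.
apply/measurable_fun_tnthP => i.
rewrite (_ : _ \o _ = (fun x : RT => r * x : RT) \o (@tnth _ RT ^~ i)).
  apply: measurableT_comp => //; exact: measurable_tnth.
by apply/funext => t /=; rewrite tnth_map.
Qed.

(** The rescaled pushforward takes the product value on rectangles, by the one-dimensional case and
    induction; uniqueness of the product measure concludes. *)
Lemma lebesgue_tuple_scale n (r : R) (A : set (n.-tuple RT)) : 0 < r ->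
  measurable A ->
  lebesgue_tuple
    [set t : n.-tuple RT | A [tuple of map (fun x : RT => r * x : RT) t]] =
  (((r^-1) ^+ n)%:E * lebesgue_tuple A)%E.
Proof.
move=> r0; elim: n A => [|n IHn] A mA.
  rewrite expr0 mul1e; congr lebesgue_tuple; apply/seteqP.
  by split=> t /=; rewrite [X in A X -> _]tuple0 [X in _ -> A X]tuple0.
pose tcons (xt : RT * n.-tuple RT) : n.+1.-tuple RT := [tuple of xt.1 :: xt.2].
have mcons : measurable_fun setT tcons by exact: measurable_cons.
pose f (xt : RT * n.-tuple RT) : RT * n.-tuple RT :=
  (r * xt.1, scale_tuple n r xt.2).
have mf : measurable_fun setT f.
  apply: measurable_fun_pair => /=.
    by apply: measurableT_comp; [exact: measurable_scale|exact: measurable_fst].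
  by apply: measurableT_comp;
    [exact: measurable_scale_tuple|exact: measurable_snd].
have rn0 : 0 <= r ^+ n.+1 by rewrite exprn_ge0// ltW.
have [nu nuE] := pushforward_measureP _ _ _ _ _ (@lebesgue_measure R \x
  @lebesgue_tuple R n)%E _ mf.
pose mu : {measure set (RT * n.-tuple RT) -> \bar R} := mscale (NngNum rn0) nu.
have -> : lebesgue_tuple A = mu (tcons @^-1` A).
  rewrite [LHS](_ : _ = (@lebesgue_measure R \x @lebesgue_tuple R n)%E (tcons
    @^-1` A))//.
  apply: (@product_measure_unique _ _ RT (n.-tuple RT : measurableType _) R
    (@lebesgue_measure R) (@lebesgue_tuple R n) mu); last first.
    by rewrite -[X in measurable X]setTI; exact: mcons.
  move=> B C mB mC; rewrite /mu/= /mscale/= nuE /pushforward.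
  rewrite [_ @^-1` _](_ : _ = ((fun x : RT =>
    r * x : RT) @^-1` B) `*` (scale_tuple n r @^-1` C))//.
  have mB' : measurable ((fun x : RT => r * x : RT) @^-1` B).
    by rewrite -[X in measurable X]setTI; exact: measurable_scale.
  have mC' : measurable (scale_tuple n r @^-1` C).
    by rewrite -[X in measurable X]setTI; exact: measurable_scale_tuple.
  rewrite [X in (_ * X)%E](product_measure1E lebesgue_measure (@lebesgue_tuple
    R n) mB' mC').
  rewrite [X in (_ * (X * _))%E](lebesgue_measure_scale r B r0 mB) [X in (_ *
    (_ * X))%E](IHn C mC).
  by rewrite muleACA !muleA -!EFinM -mulrA -exprS -exprMn mulfV ?gt_eqF//
    expr1n mul1e.
rewrite /mu/= /mscale/= nuE /pushforward muleA -EFinM -exprMn mulVf ?gt_eqF//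
  expr1n mul1e.
rewrite [LHS](_ : _ = (@lebesgue_measure R \x @lebesgue_tuple R n)%E (tcons
  @^-1` [set t : n.+1.-tuple RT | A [tuple of map (fun x : RT =>
  r * x : RT) t]]))//.
congr ((_ \x _)%E _); apply/funext => -[x t].
rewrite /mkset /preimage/= /tcons; congr A; exact: val_inj.
Qed.

End lebesgue_tuple_scale.

(** * Tangent and quadratic bounds for powers *)

Section powR_inequalities.
Context {R : realType}.
Implicit Types p q r w : R.

(** Young's inequality for the product of [w] and 1, multiplied by [p]. *)
Lemma powR_ge_tangent p w : 1 < p -> 0 <= w -> 1 + p * (w - 1) <= w `^ p.
Proof.
move=> p1 w0; have p0 : 0 < p by lra.
have q0 : 0 < p / (p - 1) by rewrite divr_gt0// subr_gt0.
have pq : p^-1 + (p / (p - 1))^-1 = 1 by field; rewrite !gt_eqF//; lra.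
have := @conjugate_powR R w 1 p (p / (p - 1)) w0 ler01 p0 q0 pq.
rewrite powR1 mulr1 invf_div mul1r -(ler_pM2l p0) mulrDr.
rewrite (_ : p * (w `^ p / p) = w `^ p); last by field; rewrite gt_eqF.
rewrite (_ : p * ((p - 1) / p) = p - 1); last by field; rewrite gt_eqF.
lra.
Qed.

Lemma powR_le_tangent r w : 0 < r -> r < 1 -> 0 <= w ->
  w `^ r <= 1 + r * (w - 1).
Proof.
move=> r0 r1 w0.
have p1 : 1 < r^-1 by rewrite invf_gt1.
have := powR_ge_tangent _ _ p1 (powR_ge0 w r).
rewrite -powRrM mulfV ?gt_eqF// powRr1//.
rewrite -(ler_pM2l r0) mulrDr mulrA mulfV ?gt_eqF//; lra.
Qed.

(** Since w^p = w^2 (1/w)^(2-p), the concave tangent bound for the exponent 2 - p at 1/w gives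
    exactly this quadratic. *)
Lemma powR_le_quadratic p w : 1 < p -> p < 2 -> 0 <= w ->
  w `^ p <= 1 + p * (w - 1) + (p - 1) * (w - 1) ^+ 2.
Proof.
move=> p1 p2; rewrite le_eqVlt => /predU1P[<-|w0].
  by rewrite powR0 ?gt_eqF//; nra.
have := powR_le_tangent (2 - p) w^-1 ltac:(lra) ltac:(lra) ltac:(by rewrite
  invr_ge0 ltW).
rewrite -(ler_pM2l (exprn_gt0 2 w0)).
have -> : w ^+ 2 * w^-1 `^ (2 - p) = w `^ p.
  rewrite -powR_inv1 1?ltW// -powRrM -powR_mulrn 1?ltW// -powRD ?(gt_eqF w0)
    ?implybT//.
  by congr powR; lra.
move=> /le_trans; apply.
have -> : w ^+ 2 * (1 + (2 - p) * (w^-1 - 1)) = w ^+ 2 + (2 - p) * (w - w ^+ 2).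
  by field; rewrite gt_eqF.
nra.
Qed.

(** For w > 0 and D = 1 + (2-p)(w-1), the concave tangent bound gives w^p >= w^2 / D, while w^2 = D
    (1 + p(w-1)) + (p-1)^2 (w-1)^2. The factor 2N in the constant serves w < 0: there 1 - w <= 2N,
    and the left side is negative. *)
Lemma powR_ge_quadratic p w N : 1 < p -> p < 2 -> 1 <= N -> `|w| <= N ->
  1 + p * (w - 1) + ((p - 1) / (2 * N)) ^+ 2 * (w - 1) ^+ 2 <= `|w| `^ p.
Proof.
move=> p1 p2 N1 wN.
have N0 : 0 < N by lra.
have c0 : 0 <= (p - 1) / (2 * N) by rewrite divr_ge0//; lra.
set c := (p - 1) / (2 * N) in c0 *.
have cN : c * (2 * N) = p - 1 by rewrite /c; field; rewrite gt_eqF.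
have [w0|w0] := ltP w 0.
  rewrite (le_trans _ (powR_ge0 _ _))//.
  have wN' : - w <= N by move: wN; rewrite ltr0_norm.
  rewrite -exprMn.
  have : 0 <= c * (1 - w) <= p - 1 by apply/andP; split; nra.
  nra.
move: wN; rewrite ger0_norm// => wN.
move: w0; rewrite le_eqVlt => /predU1P[<-|w0].
  rewrite powR0 ?gt_eqF//; last lra.
  have : 0 <= c <= p - 1 by apply/andP; split; nra.
  nra.
have := powR_le_tangent (2 - p) w ltac:(lra) ltac:(lra) ltac:(lra).
set D := 1 + (2 - p) * (w - 1) => D_ge.
have D0 : 0 < D by rewrite /D; nra.
have DN : D <= N by rewrite /D; nra.
have E : w `^ p * w `^ (2 - p) = w ^+ 2.
  rewrite -powRD ?(gt_eqF w0) ?implybT//.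
  by rewrite -powR_mulrn 1?ltW//; congr powR; lra.
have H : w ^+ 2 <= w `^ p * D by rewrite -E ler_pM2l ?powR_gt0.
rewrite -(ler_pM2r D0); apply: le_trans H.
have : c ^+ 2 * D <= (p - 1) ^+ 2.
  have h : D <= (2 * N) ^+ 2 by nra.
  by have := ler_wpM2l (sqr_ge0 c) h; rewrite -exprMn cN.
move=> /(ler_wpM2r (sqr_ge0 (w - 1))).
rewrite /D; nra.
Qed.

(** The tangent bound for the exponent q/2 at w^2. *)
Lemma powR_norm_ge_square q w : 2 < q -> 1 + q / 2 * (w ^+ 2 - 1) <= `|w| `^ q.
Proof.
move=> q2.
have -> : `|w| `^ q = (w ^+ 2) `^ (q / 2).
  rewrite -[w ^+ 2]real_normK ?num_real// -(powR_mulrn 2 (normr_ge0 w)) -powRrM.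
  by congr powR; field.
by apply: powR_ge_tangent; [lra|exact: sqr_ge0].
Qed.

End powR_inequalities.

(** * Volumes of cubes and l_p balls *)

Section volume.
Context {R : realType}.
Local Notation RT := (measurableTypeR R).

Definition measurable_rv k (A : set 'rV[R]_k) :=
  measurable [set t : k.-tuple RT | A (\row_(i < k) tnth t i)].

Lemma le_vol k (A B : set 'rV[R]_k) : A `<=` B -> (vol A <= vol B)%E.
Proof. by move=> AB; apply: le_lebesgue_tuple => t; exact: AB. Qed.

Lemma vol_ge0 k (A : set 'rV[R]_k) : (0 <= vol A)%E.
Proof. exact: measure_ge0. Qed.

Lemma vol_setU_le k (A B : set 'rV[R]_k) : measurable_rv k A ->
  measurable_rv k B -> (vol (A `|` B) <= vol A + vol B)%E.
Proof. by move=> mA mB; exact: measureU2. Qed.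

Lemma vol_setU k (A B : set 'rV[R]_k) : measurable_rv k A ->
  measurable_rv k B -> A `&` B `<=` set0 -> vol (A `|` B) = (vol A + vol B)%E.
Proof.
move=> mA mB AB0; apply: measureU => //.
by apply/seteqP; split=> t // /AB0.
Qed.

Lemma vol_cube k (r : R) : 0 <= r ->
  vol [set x : 'rV[R]_k | forall i, `|x 0 i| <= r] = ((2 * r) ^+ k)%:E.
Proof.
move=> r0.
have -> : [set x : 'rV[R]_k | forall i, `|x 0 i| <= r] =
    [set x : 'rV[R]_k | forall i, `[- r, r]%classic (x 0 i)].
  by apply/seteqP; split=> x H i; have := H i; rewrite /= in_itv/= ler_norml.
rewrite (@vol_box R k (fun=> `[- r, r]%classic))//.
under eq_bigr do rewrite lebesgue_measure_itv/= lte_fin.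
have -> : (if - r < r then (r%:E - (- r)%:E)%E else 0%E) = (2 * r)%:E.
  by case: ltP => h; rewrite -?EFinB; congr EFin; lra.
by rewrite prodEFin prodr_const card_ord.
Qed.

Definition lp_sublevel (p : R) m (r : R) : set 'rV[R]_m :=
  [set x | \sum_(i < m) `|x 0 i| `^ p <= r].

Lemma measurable_lp_sublevel (p : R) m r : measurable_rv m (lp_sublevel p m r).
Proof.
rewrite /measurable_rv/lp_sublevel/=.
have mf : measurable_fun setT (fun t : m.-tuple RT =>
  \sum_(i < m) `|tnth t i| `^ p : R).
  apply: measurable_sum => i.
  apply: (measurableT_comp (measurable_powR p)).
  apply: measurableT_comp; first exact: normr_measurable.
  exact: measurable_tnth.
rewrite (_ : mkset _ = (fun t : m.-tuple RT =>
  \sum_(i < m) `|tnth t i| `^ p : R) @^-1` `]-oo, r]%classic).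
  by rewrite -[X in measurable X]setTI; exact: mf.
apply/funext => t; rewrite /mkset /preimage/= in_itv/=.
by under eq_bigr do rewrite mxE.
Qed.

Lemma norm_lp_ball (p : R) m (x : 'rV[R]_m) i : 0 < p -> lp_ball p m x ->
  `|x 0 i| <= 1.
Proof.
move=> p0 xB.
have : `|x 0 i| `^ p <= 1.
  apply: le_trans xB; rewrite (bigD1 i)//= lerDl.
  by apply: sumr_ge0 => j _; exact: powR_ge0.
rewrite leNgt [in X in _ -> X]leNgt; apply: contra => x1.
have := @gt0_ltr_powR R p p0 1 `|x 0 i|; rewrite !nnegrE powR1.
by apply => //.
Qed.

Lemma vol_lp_ball_lty (p : R) m : 0 < p -> (vol (lp_ball p m) < +oo)%E.
Proof.
move=> p0; apply: (@le_lt_trans _ _ (vol [set x : 'rV[R]_m | forall i,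
  `|x 0 i| <= 1])).
  by apply: le_vol => x xB i; apply: norm_lp_ball xB.
by rewrite vol_cube// ltry.
Qed.

Lemma vol_lp_ball_gt0 (p : R) m : 0 < p -> (0 < vol (lp_ball p m))%E.
Proof.
(* Taking [m.+1] rather than [m] keeps the half-side positive when [m] is 0. *)
move=> p0; pose r : R := m.+1%:R^-1 `^ p^-1.
have r0 : 0 < r by rewrite powR_gt0// invr_gt0.
apply: (@lt_le_trans _ _ (vol [set x : 'rV[R]_m | forall i, `|x 0 i| <= r])).
  by rewrite vol_cube ?ltW// lte_fin exprn_gt0// mulr_gt0.
apply: le_vol => x xr; rewrite /lp_ball/=.
apply: (@le_trans _ _ (\sum_(i < m) m.+1%:R^-1)).
  apply: ler_sum => i _; have := xr i.
  move=> /(ge0_ler_powR (ltW p0));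
    rewrite !nnegrE normr_ge0 (ltW r0) => /(_ erefl erefl).
  by rewrite /r -powRrM mulVf ?gt_eqF// powRr1// invr_ge0.
by rewrite sumr_const card_ord -[leLHS]mulr_natl ler_pdivrMr// mul1r ler_nat.
Qed.

Lemma vol_lp_ballE (p : R) m : 0 < p ->
  {v : R | 0 < v & vol (lp_ball p m) = v%:E}.
Proof.
move=> p0; exists (fine (vol (lp_ball p m))).
  by rewrite fine_gt0// vol_lp_ball_gt0// vol_lp_ball_lty.
by rewrite fineK// ge0_fin_numE ?vol_lp_ball_lty// vol_ge0.
Qed.

Lemma vol_lp_sublevel (p : R) m r : 0 < p -> 0 < r ->
  vol (lp_sublevel p m r) = ((r `^ (m%:R / p))%:E * vol (lp_ball p m))%E.
Proof.
move=> p0 r0; pose c := r `^ (- p^-1).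
have c0 : 0 < c by rewrite powR_gt0.
have := lebesgue_tuple_scale m c [set t : m.-tuple RT | lp_ball p m (\row_i
  tnth t i)] c0 (measurable_lp_sublevel p m 1).
rewrite [RHS](_ : _ = (r `^ (m%:R / p))%:E * vol (lp_ball p m))%E; last first.
  by rewrite /c powRN invrK -powR_mulrn ?powR_ge0// -powRrM mulrC.
move=> <-; congr lebesgue_tuple; apply/seteqP.
have E (t : m.-tuple RT) : \sum_(i < m) `|(\row_i tnth [tuple of [seq c * x | x
  <- t]] i) 0 i : R| `^ p
    = r^-1 * \sum_(i < m) `|(\row_i tnth t i) 0 i : R| `^ p.
  rewrite mulr_sumr; apply: eq_bigr => i _; rewrite !mxE tnth_map normrM.
  rewrite powRM// gtr0_norm// /c -powRrM mulNr mulVf ?gt_eqF//.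
  by rewrite powR_inv1// ltW.
split=> t; rewrite /mkset /lp_sublevel /lp_ball /mkset E.
  by move=> H; rewrite ler_pdivrMl// mulr1.
by rewrite ler_pdivrMl// mulr1.
Qed.

End volume.

(** * Integrals of powers *)

Section powR_integral.
Context {R : realType}.
Local Notation mu := (@lebesgue_measure R).

Lemma powR_LRcontinuous (k b : R) : 0 < k -> 0 < b ->
  derivable_oo_LRcontinuous (@powR R ^~ k) 0 b.
Proof.
move=> k0 b0; split => [x||].
- by rewrite in_itv/= => /andP[x0 _]; apply: derivable_powR;
  rewrite in_itv/= x0.
- by rewrite powR0 ?gt_eqF//; exact: powR_cvg0.
- have H : {for b, continuous (@powR R ^~ k)}.
    apply/differentiable_continuous/derivable1_diffP.
    by apply: derivable_powR; rewrite in_itv/= b0.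
  by apply: cvg_at_left_filter; exact: H.
Qed.

Lemma integral_powR (k b : R) : 0 < k -> 0 < b ->
  (\int[mu]_(x in `[0%R, b]) (x `^ k)%:E = (b `^ (k + 1) / (k + 1))%:E)%E.
Proof.
move=> k0 b0; have k10 : 0 < k + 1 by rewrite addr_gt0.
rewrite (@continuous_FTC2 _ _ (fun x => (k + 1)^-1 * x `^ (k + 1)))//.
- by rewrite powR0 ?gt_eqF// mulr0 sube0 mulrC.
- exact/derivable_oo_LRcontinuous_within/powR_LRcontinuous.
- have [d cl cr] := powR_LRcontinuous (k + 1) b k10 b0.
  split => [x xb||].
  + by apply: derivableM => //; exact: d.
  + exact: cvgMr.
  + exact: cvgMr.
- move=> x; rewrite in_itv/= => /andP[x0 _].
  have H := @is_derive1_powR R (k + 1) x x0.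
  rewrite derive1E deriveMl//.
  by rewrite derive_val addrK mulrA mulVf ?gt_eqF// mul1r.
Qed.

Lemma integral_powR_onem (k b : R) : 0 < k -> 0 < b <= 1 ->
  (\int[mu]_(x in `[(1 - b)%R, 1%R]) ((1 - x) `^ k)%:E =
   (b `^ (k + 1) / (k + 1))%:E)%E.
Proof.
move=> k0 /andP[b0 b1]; rewrite -integral_powR//.
rewrite integration_by_substitution_onem ?(ltW b0)//.
exact/derivable_oo_LRcontinuous_within/powR_LRcontinuous.
Qed.

End powR_integral.

(** * Volume of the cap of the l_p ball at a vertex *)

Section lp_cap.
Context {R : realType}.
Local Notation RT := (measurableTypeR R).
Local Notation mu := (@lebesgue_measure R).

(** The slice at height x is a sublevel set of level 1 - x^p <= p(1-x), so its volume is at most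
    (p(1-x))^(m/p) times that of the ball; this is then integrated over [1-b, 1]. *)
Lemma vol_lp_cap_le (p : R) m (b : R) : 1 < p -> (0 < m)%N -> 0 < b <= 1 ->
  (vol (lp_ball p m.+1 `&` [set x | (1 - b <= x 0 ord0)%R]) <=
   ((p * b) `^ (m%:R / p + 1) / (m%:R + p))%:E * vol (lp_ball p m))%E.
Proof.
move=> p1 m0 /andP[b0 b1]; have p0 : 0 < p by lra.
have [v v0 vE] := vol_lp_ballE p m p0; rewrite vE.
pose k := m%:R / p; have k0 : 0 < k by rewrite divr_gt0// ltr0n.
pose f (x : R) : \bar R := ((p `^ k * v)%:E * ((1 - x) `^ k)%:E)%E.
have mf : measurable_fun setT (fun x : R => (1 - x) `^ k : R).
  apply: (measurableT_comp (measurable_powR k)).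
  exact: measurable_funB.
have If : (\int[mu]_(x in `[(1 - b)%R, 1%R]) f x =
    (((p * b) `^ (k + 1) / (m%:R + p)) * v)%:E)%E.
  rewrite ge0_integralZl//; last 3 first.
  - apply/measurable_EFinP; exact: measurable_funTS.
  - by move=> x _; rewrite lee_fin powR_ge0.
  - by rewrite lee_fin mulr_ge0 ?powR_ge0// ltW.
  rewrite integral_powR_onem// ?b0// -EFinM; congr EFin.
  rewrite powRM ?(ltW b0) ?(ltW p0)// (@powRD _ p) ?(gt_eqF p0) ?implybT//
    powRr1 ?(ltW p0)//.
  have -> : k + 1 = (m%:R + p) / p by rewrite /k; field; rewrite gt_eqF.
  have m1 : 0 < m%:R + p by rewrite addr_gt0// ltr0n.
  by field; rewrite !gt_eqF.
rewrite -EFinM -If integral_mkcond /vol lebesgue_tuple_consE.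
apply: le_integral_setT => x; first exact: measure_ge0.
have tE (t : m.-tuple RT) : \sum_(i < m.+1) `|(\row_i tnth [tuple of x :: t] i)
  0 i : R| `^ p =
    `|x| `^ p + \sum_(i < m) `|(\row_i tnth t i) 0 i : R| `^ p.
  rewrite big_ord_recl mxE tnth0; congr +%R; apply: eq_bigr => i _.
  by rewrite !mxE tnthS.
rewrite patchE; case: ifPn => [|xI]; last first.
  rewrite (_ : mkset _ = set0) ?measure0//.
  apply/seteqP; split=> t //= [tB]; rewrite mxE tnth0 => bx.
  case/negP: xI; rewrite inE/= in_itv/= bx/=.
  have := norm_lp_ball p _ _ ord0 p0 tB; rewrite mxE tnth0.
  by apply: le_trans; exact: ler_norm.
rewrite inE/= in_itv/= => /andP[bx x1].
have x0 : 0 <= x by lra.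
have xp := powR_ge_tangent p x p1 x0.
(* At x = 1 the level is 0 and scaling does not apply: the slice lies in a cube of side 0, which is
   null because [m] is positive. *)
move: x1; rewrite le_eqVlt => /predU1P[x1|x1].
  apply: (@le_trans _ _ 0%E);
    last by rewrite /f mule_ge0// lee_fin ?mulr_ge0 ?powR_ge0 ?(ltW v0).
  have -> : (0 : \bar R)%E = vol [set x : 'rV[R]_m | forall i, `|x 0 i| <= 0].
    by rewrite vol_cube// mulr0 expr0n gtn_eqF.
  apply: le_lebesgue_tuple => t /= [+ _] i.
  rewrite /lp_ball/= tE x1 normr1 powR1 gerDl => s0.
  have : `|(\row_i tnth t i) 0 i : R| `^ p <= 0.
    apply: le_trans s0; rewrite (bigD1 i)//= lerDl.
    by apply: sumr_ge0 => j _; exact: powR_ge0.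
  by rewrite le_eqVlt ltNge powR_ge0 orbF powR_eq0 => /andP[/eqP ->].
have r0 : 0 < p * (1 - x) by rewrite mulr_gt0// subr_gt0.
have -> : f x = vol (lp_sublevel p m (p * (1 - x))).
  rewrite vol_lp_sublevel// vE /f -!EFinM powRM ?(ltW p0) ?subr_ge0 ?(ltW x1)//.
  by congr EFin; rewrite mulrAC.
apply: le_lebesgue_tuple => t /= [+ _].
rewrite /lp_ball /lp_sublevel /= tE ger0_norm//; lra.
Qed.

End lp_cap.

(** * Floating body of the l_p ball, at a vertex and on the diagonal *)

Section floating_body_lp.
Context {R : realType}.
Local Notation RT := (measurableTypeR R).

Lemma dotmul_delta n (x : 'rV[R]_n) i : dotmul (delta_mx 0 i) x = x 0 i.
Proof.
rewrite /dotmul (bigD1 i)//= mxE !eqxx mul1r big1 ?addr0// => j ji.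
by rewrite mxE (negbTE ji) andbF mul0r.
Qed.

Lemma floating_body_lp_le (p : R) m (b delta : R) (x : 'rV[R]_m.+1) :
  1 < p -> (0 < m)%N -> 0 < b <= 1 ->
  (((p * b) `^ (m%:R / p + 1) / (m%:R + p))%:E * vol (lp_ball p m)
     <= delta%:E * vol (lp_ball p m.+1))%E ->
  floating_body (lp_ball p m.+1) delta x -> x 0 ord0 <= 1 - b.
Proof.
move=> p1 m0 b01 small /(_ (delta_mx 0 ord0) (1 - b)).
rewrite dotmul_delta; apply.
  by apply/eqP => /rowP/(_ ord0)/eqP; rewrite !mxE !eqxx/= oner_eq0.
apply: le_trans small; apply: le_trans (vol_lp_cap_le p m b p1 m0 b01).
by apply: le_vol => y /= [yB]; rewrite dotmul_delta.
Qed.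

(** Bounding the coordinate sum controls the extent along the diagonal separately, so that the box
    can have size of order e in the other directions and e^2 in this one, as a cap of a curved
    boundary does. *)
Definition shear_box k (a : 'I_k -> R) (r b h : R) : set 'rV[R]_k.+1 :=
  [set x | (forall i : 'I_k, a i <= x 0 (widen_ord (leqnSn k) i) <= a i + r) /\
           b <= \sum_i x 0 i <= b + h].

Lemma vol_shear_box k (a : 'I_k -> R) (r b h : R) : 0 <= r -> 0 <= h ->
  vol (shear_box k a r b h) = (r ^+ k * h)%:E.
Proof.
move=> r0 h0; rewrite -(lebesgue_tuple_shear _ a _ b _ r0 h0).
congr lebesgue_tuple; apply/funext => t; rewrite /mkset.
congr (_ /\ _); last by under eq_bigr do rewrite mxE.
by apply/propext; split=> H i; have := H i; rewrite mxE.
Qed.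

(* The halfspace through the point cuts off at least one orthant of a sheared
   box centred at the point. *)
Lemma floating_body_lp_diag (p : R) m (nu e delta : R) :
  1 < p -> p < 2 -> (0 < m)%N -> 0 < nu -> nu `^ p = m.+1%:R^-1 ->
  0 < e -> e <= (2 * m.+1%:R)^-1 ->
  (delta%:E * vol (lp_ball p m.+1) <
    ((nu * e / (2 * m.+1%:R)) ^+ m * (nu * e ^+ 2))%:E)%E ->
  floating_body (lp_ball p m.+1) delta (const_mx (nu * (1 - e ^+ 2))).
Proof.
move=> p1 p2 m0 nu0 nup e0 en small u b _ bsmall.
set n : R := m.+1%:R in nup en small *.
have n2 : 2 <= n by rewrite /n (ler_nat R 2).
have n0 : 0 < n by lra.
have n2e : e * (2 * n) <= 1 by rewrite -ler_pdivlMr ?mul1r// mulr_gt0.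
have mn : m%:R = n - 1 by rewrite /n -natr1 addrK.
pose r := nu * e / (2 * n); pose h := nu * e ^+ 2.
have r0 : 0 < r by rewrite /r divr_gt0 ?mulr_gt0//; lra.
have h0 : 0 < h by rewrite /h mulr_gt0// exprn_gt0.
pose x0 := nu * (1 - e ^+ 2).
rewrite leNgt; apply/negP => bx0.
move: bsmall; apply/negP; rewrite -ltNge.
apply: (lt_le_trans small); rewrite -/r -/h.
pose l := @ord_max m.
(* The pairing of [u] with the displacement is the sum over i < m of (u_i - u_l)(t_i - x0), plus u_l
   times the deviation of the coordinate sum. The signs chosen in [a] and [c] make every term
   nonnegative. *)
pose a (i : 'I_m) := if u 0 l <= u 0 (widen_ord (leqnSn m) i) then x0 else x0 -
  r.
pose c := if 0 <= u 0 l then n * x0 else n * x0 - h.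
rewrite -(vol_shear_box m a r c h (ltW r0) (ltW h0));
  apply: le_vol => t [ta tc].
have tr i : `|t 0 (widen_ord (leqnSn m) i) - x0| <= r.
  have := ta i; rewrite /a; case: ifP => _ /andP[? ?]; rewrite ler_norml;
    apply/andP; split; lra.
have th : `|\sum_i t 0 i - n * x0| <= h.
  have := tc; rewrite /c; case: ifP => _ /andP[? ?]; rewrite ler_norml;
    apply/andP; split; lra.
split; last first.
  apply: (le_trans (ltW bx0)).
  rewrite -subr_ge0 /dotmul -sumrB.
  have -> : \sum_i (u 0 i * t 0 i - u 0 i * (const_mx x0 : 'rV[R]_m.+1) 0 i) =
     \sum_(i < m) (u 0 (widen_ord (leqnSn m) i) - u 0 l) * (t 0 (widen_ord
       (leqnSn m) i) - x0)
      + u 0 l * (\sum_i t 0 i - n * x0).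
    under eq_bigr do rewrite mxE -mulrBr.
    have -> : \sum_i t 0 i - n * x0 = \sum_i (t 0 i - x0).
      by rewrite sumrB sumr_const card_ord -[x0 *+ _]mulr_natl.
    rewrite [in LHS]big_ord_recr [X in u 0 l * X]big_ord_recr/= [in RHS]mulrDr
      addrA; congr +%R.
    by rewrite mulr_sumr -big_split/=; apply: eq_bigr => i _; ring.
  apply: addr_ge0.
    apply: sumr_ge0 => i _; have := ta i; rewrite /a; case: ifPn => [ui|];
      last rewrite -ltNge => ui.
    by move=> /andP[? ?]; apply: mulr_ge0; lra.
    move=> /andP[? ?]; apply: mulr_le0; lra.
  have := tc; rewrite /c; case: ifPn => [ui|]; last rewrite -ltNge => ui.
  by move=> /andP[? ?]; apply: mulr_ge0; lra.
  move=> /andP[? ?]; apply: mulr_le0; lra.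
(* The last coordinate is recovered as the sum minus the first m, whence the deviation h + m r. *)
have txh i : `|t 0 i - x0| <= h + m%:R * r.
  have m1r : r <= m%:R * r by rewrite ler_peMl ?(ltW r0)// ler1n.
  have [j ->|->] := unliftP ord_max i.
    rewrite (_ : lift _ _ = widen_ord (leqnSn m) j); last first.
      by apply: val_inj; rewrite /= /bump leqNgt ltn_ord.
    by apply: le_trans (tr j) _; lra.
  have -> : t 0 ord_max - x0 = (\sum_i t 0 i - n * x0)
      - \sum_(i < m) (t 0 (widen_ord (leqnSn m) i) - x0).
    have -> : \sum_i t 0 i = \sum_(i < m) t 0 (widen_ord (leqnSn m) i) + t 0
      ord_max.
      by rewrite big_ord_recr.
    by rewrite sumrB sumr_const card_ord -[x0 *+ _]mulr_natl mn; ring.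
  apply: le_trans (ler_normB _ _) _; apply: lerD => //.
  apply: le_trans (ler_norm_sum _ _ _) _.
  apply: (@le_trans _ _ (\sum_(i < m) r)); first exact: ler_sum.
  by rewrite sumr_const card_ord mulr_natl.
have te i : `|t 0 i / nu - 1| <= e.
  have -> : t 0 i / nu - 1 = (t 0 i - x0) / nu - e ^+ 2.
    by rewrite /x0; field; rewrite gt_eqF.
  apply: le_trans (ler_normB _ _) _; rewrite (ger0_norm (sqr_ge0 e)).
  rewrite normrM (gtr0_norm (_ : 0 < nu^-1)) ?invr_gt0//.
  rewrite -lerBrDr ler_pdivrMr//; apply: le_trans (txh i) _.
  rewrite /h /r mn.
  have -> : nu * e ^+ 2 + (n - 1) * (nu * e / (2 * n)) =
     (e ^+ 2 + e / 2 - e / (2 * n)) * nu by field; rewrite gt_eqF.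
  rewrite ler_pM2r//.
  have : e ^+ 2 <= e / (2 * n).
    by rewrite ler_pdivlMr ?mulr_gt0// expr2 -mulrA ler_piMr// ltW.
  have e4 : e ^+ 2 <= e / 4.
    by rewrite ler_pdivlMr// expr2 -mulrA ler_piMr// ?(ltW e0)//; nra.
  by set q := e / (2 * n) => eq; lra.
rewrite /lp_ball/=.
have e1 : e <= 1 / 4 by nra.
have w0 i : 0 <= t 0 i / nu.
  by have := te i; rewrite ler_norml => /andP[? ?]; lra.
have -> : \sum_(i < m.+1) `|t 0 i| `^ p = n^-1 * \sum_(i < m.+1) (t 0 i / nu)
  `^ p.
  rewrite mulr_sumr; apply: eq_bigr => i _.
  rewrite -nup -powRM ?(ltW nu0)// mulrC divfK ?gt_eqF// ger0_norm//.
  by rewrite -(pmulr_lge0 _ (_ : 0 < nu^-1)) ?invr_gt0// .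
rewrite ler_pdivrMl// mulr1.
(* After the quadratic bound, the first-order terms add up to at most p(e^2 - n e^2), so the total
   is at most n + (p - n) e^2, and p < 2 <= n. *)
apply: (@le_trans _ _ (\sum_(i < m.+1) (1 + p * (t 0 i / nu - 1) + (p - 1) * e
  ^+ 2))).
  apply: ler_sum => i _; apply: le_trans (powR_le_quadratic p _ p1 p2 (w0 i)) _.
  rewrite lerD2l; apply: ler_wpM2l; first lra.
  by rewrite -(@real_normK _ (t 0 i / nu - 1)) ?num_real// ler_sqr ?nnegrE//
    ltW.
have cst (x : R) : \sum_(i < m.+1) x = n * x
  by rewrite sumr_const card_ord mulr_natl.
rewrite !big_split/= -mulr_sumr sumrB -mulr_suml !cst.
have ts : (\sum_(i < m.+1) t 0 i) / nu <= n * (1 - e ^+ 2) + e ^+ 2.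
  rewrite ler_pdivrMr//; move: th; rewrite ler_norml /x0 /h => /andP[_ ?]; lra.
have e20 := sqr_ge0 e.
set T := _ / nu in ts *.
have h1 : p * (T - n) <= p * (e ^+ 2 - n * e ^+ 2) by rewrite ler_wpM2l//; lra.
have h2 : 0 <= e ^+ 2 * (n - p) by rewrite mulr_ge0//; lra.
lra.
Qed.

End floating_body_lp.

(** * Polars of l_p balls and convex hulls *)

Section polar_lp.
Context {R : realType}.

Lemma dotmulC n (x y : 'rV[R]_n) : dotmul x y = dotmul y x.
Proof. by apply: eq_bigr => i _; rewrite mulrC. Qed.

Lemma dotmulDr n (x y z : 'rV[R]_n) :
  dotmul x (y + z) = dotmul x y + dotmul x z.
Proof.
by rewrite /dotmul -big_split; apply: eq_bigr => i _; rewrite mxE mulrDr.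
Qed.

Lemma dotmulZr n a (x y : 'rV[R]_n) : dotmul x (a *: y) = a * dotmul x y.
Proof.
by rewrite /dotmul mulr_sumr; apply: eq_bigr => i _; rewrite mxE mulrCA.
Qed.

Lemma dotmul_const n (x : 'rV[R]_n) a :
  dotmul x (const_mx a) = a * \sum_i x 0 i.
Proof.
by rewrite /dotmul mulr_sumr; apply: eq_bigr => i _; rewrite mxE mulrC.
Qed.

Lemma polar_lp_ball (p q : R) n : 0 < p -> 0 < q -> p^-1 + q^-1 = 1 ->
  polar (lp_ball p n) = lp_ball q n.
Proof.
move=> p0 q0 pq; apply/seteqP; split=> [y yP|y yB x xB]; last first.
  apply: (@le_trans _ _ (\sum_(i < n) (`|x 0 i| `^ p / p + `|y 0 i| `^ q / q))).
    apply: ler_sum => i _; apply: le_trans (ler_norm _) _.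
    by rewrite normrM conjugate_powR.
  rewrite big_split/= -!mulr_suml -pq lerD// ler_piMl// ?invr_ge0 ltW//.
rewrite /lp_ball/= leNgt; apply/negP.
set S := \sum_(i < n) _ => S1.
have S0 : 0 < S by apply: lt_trans S1.
(* The equality case of Hölder's inequality: this [x] lies in the l_p ball and pairs with [y] to
   S^(1/q) > 1. *)
pose x : 'rV[R]_n := \row_i (Num.sg (y 0 i) * `|y 0 i| `^ (q - 1) * S `^ (-
  p^-1)).
have qp : (q - 1) * p = q.
  have : p * q * (p^-1 + q^-1) = p + q by field; rewrite !gt_eqF.
  by rewrite pq; lra.
have xB : lp_ball p n x.
  rewrite /lp_ball/= le_eqVlt; apply/orP; left; apply/eqP.
  rewrite -[RHS](mulVf (negbT (gt_eqF S0))) [in RHS]/S mulr_sumr -/S;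
    apply: eq_bigr => i _.
  rewrite mxE !normrM [`|S `^ _|]ger0_norm ?powR_ge0// powRM ?mulr_ge0
    ?powR_ge0//.
  rewrite -powRrM mulNr mulVf ?gt_eqF// powR_inv1 ?(ltW S0)// mulrC; congr *%R.
  rewrite normr_sg; have [->|_] := eqVneq (y 0 i) 0.
    by rewrite mul0r normr0 !powR0// gt_eqF.
  by rewrite mul1r ger0_norm ?powR_ge0// -powRrM qp.
have := yP x xB.
have -> : dotmul x y = S `^ q^-1.
  rewrite /dotmul.
  have E (i : 'I_n) : x 0 i * y 0 i = S `^ (- p^-1) * `|y 0 i| `^ q.
    rewrite mxE -(mulr_powRB1 (normr_ge0 (y 0 i)) q0).
    by rewrite [X in _ = _ * (X * _)]normrEsg; ring.
  under eq_bigr do rewrite E.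
  rewrite -mulr_sumr -/S -[X in _ * X]powRr1 ?(ltW S0)// -powRD ?(gt_eqF S0)
    ?implybT//.
  by congr powR; rewrite -pq; ring.
have iq0 : 0 < q^-1 by rewrite invr_gt0.
rewrite leNgt; have := @gt0_ltr_powR R q^-1 iq0 1 S; rewrite !nnegrE powR1.
by move=> ->//; exact: ltW.
Qed.

(** The sublevel set of the functional [x] at this maximum is convex and contains both the polar and
    [y]. *)
Lemma conv_hull_polar_le n (C : set 'rV[R]_n) (x y z : 'rV[R]_n) :
  conv_hull (polar C `|` [set y]) z -> C x ->
  dotmul x z <= Num.max 1 (dotmul x y).
Proof.
move=> zK Cx.
pose A : set 'rV[R]_n := [set z | dotmul x z <= Num.max 1 (dotmul x y)].
suff : A z by [].
apply: zK; split.
  move=> u v l; rewrite !inE /A/= => uA vA.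
  rewrite dotmulDr !dotmulZr.
  set M := Num.max _ _ in uA vA *.
  have -> : M = l%:num * M + (1 - l%:num) * M by ring.
  by apply: lerD; apply: ler_wpM2l => //; rewrite subr_ge0.
by move=> u [uP|->]; rewrite /A/= le_max ?lexx ?orbT// uP.
Qed.

Lemma conv_hull_segment n (A : set 'rV[R]_n) (k y : 'rV[R]_n) (l : R) :
  A k -> A y -> 0 <= l -> l <= 1 -> conv_hull A (l *: k + (1 - l) *: y).
Proof.
move=> Ak Ay l0 l1 B [cB AB].
have := cB k y (Itv01 l0 l1); rewrite !inE; apply; exact: AB.
Qed.

End polar_lp.

(** * Illumination body of the polar ball on the diagonal *)

Section illumination_body_diag.
Context {R : realType}.
Local Notation RT := (measurableTypeR R).

(* Here x = nu (1 + xi) is a point of the l_p ball and z = k (1 + zeta) a point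
   of the hull outside the polar ball with <x, z> > 1.  Strict convexity of
   |.|^p bounds sum xi^2 by O(s); the cross term in <x, z> is then absorbed by
   sum zeta^2. *)
Lemma near_contact_estimate n (xi zeta : 'I_n -> R) (p c s : R) :
  0 < p -> 0 < c ->
  p * (\sum_i xi i) + c * (\sum_i xi i ^+ 2) <= 0 ->
  - (n%:R * s) <= \sum_i xi i ->
  - (n%:R * s) <= \sum_i xi i + \sum_i zeta i + \sum_i xi i * zeta i ->
  2 * (\sum_i zeta i) + \sum_i zeta i ^+ 2 <= 0 ->
  let M := n%:R + p * n%:R / c in
  \sum_i zeta i ^+ 2 <= 4 * M * s /\ - (2 * M * s) <= \sum_i zeta i <= 0.
Proof.
move=> p0 c0 h1 h2 h3 h4 M.
have X0 : 0 <= \sum_i xi i ^+ 2 by apply: sumr_ge0 => i _; exact: sqr_ge0.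
have Z0 : 0 <= \sum_i zeta i ^+ 2 by apply: sumr_ge0 => i _; exact: sqr_ge0.
(* The weight 1/4 is below the 1/2 with which the last hypothesis bounds the sum of [zeta], so a
   quarter of the squares survives. *)
have G : \sum_i xi i * zeta i <= \sum_i xi i ^+ 2 + (\sum_i zeta i ^+ 2) / 4.
  rewrite mulr_suml -big_split/=; apply: ler_sum => i _.
  have := sqr_ge0 (xi i - zeta i / 2); rewrite !expr2; lra.
move: X0 Z0 G h1 h2 h3 h4.
set X := \sum_i xi i ^+ 2; set Z := \sum_i zeta i ^+ 2.
set a := \sum_i xi i; set b := \sum_i zeta i; set g := \sum_i xi i * zeta i.
move=> X0 Z0 G h1 h2 h3 h4.
have a0 : a <= 0.
  rewrite -(ler_pM2l p0) mulr0; have : 0 <= c * X by rewrite mulr_ge0// ltW.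
  lra.
have Xs : X <= p * n%:R / c * s.
  have -> : p * n%:R / c * s = p * (n%:R * s) / c by field; rewrite gt_eqF.
  rewrite ler_pdivlMr// mulrC.
  have : p * - (n%:R * s) <= p * a by rewrite ler_pM2l.
  lra.
rewrite /M mulrDr !mulrDl.
set q := p * n%:R / c in Xs *.
by split; [lra|apply/andP; split; lra].
Qed.

Lemma measurable_shear_box k (a : 'I_k -> R) (r b h : R) :
  measurable_rv k.+1 (shear_box k a r b h).
Proof.
rewrite /measurable_rv /shear_box.
have ms : measurable_fun setT (fun t : k.+1.-tuple RT => \sum_i tnth t i : R).
  by apply: measurable_sum => i; exact: measurable_tnth.
rewrite (_ : mkset _ =
  (\bigcap_(i in [set: 'I_k]) ((fun t : k.+1.-tuple RT =>
    tnth t (widen_ord (leqnSn k) i))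
      @^-1` `[a i, a i + r]%classic)) `&`
  ((fun t : k.+1.-tuple RT => \sum_i tnth t i : R) @^-1` `[b, b + h]%classic)).
  apply: measurableI.
    apply: fin_bigcap_measurable => // i _.
    rewrite -[X in measurable X]setTI.
    exact: (@measurable_tnth _ RT _ (widen_ord (leqnSn k) i) measurableT _
      (measurable_itv _)).
  by rewrite -[X in measurable X]setTI; apply: ms => //; exact: measurable_itv.
have sE (t : k.+1.-tuple RT) : \sum_i (\row_j tnth t j : 'rV[R]_k.+1) 0 i =
  \sum_i tnth t i.
  by apply: eq_bigr => i _; rewrite mxE.
apply/seteqP; split=> t /=; rewrite in_itv/= sE => -[ta tb]; split=> // i.
  by move=> _ /=; rewrite in_itv/=; have := ta i; rewrite mxE.
by have := ta i I; rewrite /= in_itv/= mxE.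
Qed.

(** The hull exceeds the ball only inside a sheared box, of extent of order e in m coordinates and
    e^2 in the coordinate sum, hence of volume of order e^(m+2). *)
Lemma illumination_body_lp_diag (p q : R) m (mu : R) :
  1 < p -> p < 2 -> 2 < q -> p^-1 + q^-1 = 1 ->
  0 < mu -> mu `^ q = m.+1%:R^-1 ->
  {A : R | 0 < A & forall e delta', 0 < e -> e <= 1 ->
    A * e ^+ m.+2 <= delta' ->
    illumination_body (polar (lp_ball p m.+1)) delta'
      (const_mx (mu * (1 + e ^+ 2)))}.
Proof.
move=> p1 p2 q2 pq mu0 muq.
have p0 : 0 < p by lra.
have q0 : 0 < q by lra.
set n : R := m.+1%:R in muq *.
have n0 : 0 < n by rewrite ltr0n.
have n1 : 1 <= n by rewrite ler1n.
(* The coordinate of the diagonal point of the l_p ball, which pairs to 1 with the diagonal point of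
   the l_q ball. *)
pose nu := (n * mu)^-1.
have nu0 : 0 < nu by rewrite invr_gt0 mulr_gt0.
have numu : nu * mu = n^-1 by rewrite /nu; field; rewrite !gt_eqF.
have nuE : nu = n `^ (- p^-1).
  have muE : mu = n `^ (- q^-1).
    rewrite -[LHS](powRr1 (ltW mu0)) -(mulfV (negbT (gt_eqF q0))) powRrM muq.
    by rewrite -powR_inv1 ?(ltW n0)// -powRrM mulN1r.
  rewrite /nu muE -[X in X * _]powRr1 ?(ltW n0)// -powRD ?(gt_eqF n0)
    ?implybT//.
  by rewrite -powRN; congr powR; rewrite -pq; ring.
have nup : nu `^ p = n^-1.
  by rewrite nuE -powRrM mulNr mulVf ?gt_eqF// powR_inv1// ltW.
have nu1 : nu <= 1.
  by rewrite nuE -[leRHS](powRr0 n) ler_powR// oppr_le0 invr_ge0 ltW.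
(* The constant of [powR_ge_quadratic] with N = 1/nu, a bound for x_i / nu since |x_i| <= 1. *)
pose c := ((p - 1) / (2 * nu^-1)) ^+ 2.
have nuV0 : 0 < nu^-1 by rewrite invr_gt0.
have c0 : 0 < c.
  by apply/exprn_gt0/divr_gt0; [rewrite subr_gt0|exact: mulr_gt0].
have [M ME] : {M | M = n + p * n / c} by exists (n + p * n / c).
have M1 : 1 <= M by rewrite ME -[1]addr0 lerD// divr_ge0 ?mulr_ge0 ?ltW//; lra.
have M0 : 0 < M by lra.
have [v v0 vE] := vol_lp_ballE q m.+1 q0.
exists ((2 * mu) ^+ m.+1 * (4 * M) ^+ m * (2 * M) / v).
  by rewrite divr_gt0// mulr_gt0 ?mulr_gt0 ?exprn_gt0// ?mulr_gt0.
move=> e delta' e0 e1 Ae; rewrite /illumination_body/=.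
rewrite (polar_lp_ball p q)//.
set s := e ^+ 2.
have s0 : 0 < s by rewrite exprn_gt0.
have s1 : s <= 1 by rewrite expr_le1// ltW.
have [k kE] : {k | k = mu * (1 + s)} by exists (mu * (1 + s)).
rewrite -kE; set y := const_mx _.
have k0 : 0 < k by rewrite kE mulr_gt0//; lra.
pose r := k * (4 * M * e); pose h := k * (2 * M * s).
have r0 : 0 <= r by rewrite !mulr_ge0// ltW//; lra.
have h0 : 0 <= h by rewrite !mulr_ge0// ltW//; lra.
pose S := shear_box m (fun=> k * (1 - 2 * M * e)) r (k * (n - 2 * M * s)) h.
suff sub : conv_hull (lp_ball q m.+1 `|` [set y]) `<=` lp_ball q m.+1 `|` S.
  apply: le_trans (le_vol _ _ _ sub) _.
  apply: le_trans (vol_setU_le _ _ _ (measurable_lp_sublevel q m.+1 1)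
    (measurable_shear_box _ _ _ _ _)) _.
  rewrite vol_shear_box// vE -!EFinD -EFinM lee_fin mulrDl mul1r lerD2l.
  move: Ae; rewrite -(ler_pM2r v0) => /(le_trans _); apply.
  rewrite [leRHS]mulrAC divfK ?gt_eqF//.
  rewrite /r /h.
  pose B := (4 * M) ^+ m * (2 * M) * e ^+ m.+2.
  have B0 : 0 <= B.
    apply: mulr_ge0; last exact/exprn_ge0/ltW.
    by apply: mulr_ge0; [apply: exprn_ge0|]; apply: mulr_ge0; rewrite // ltW.
  have -> : (k * (4 * M * e)) ^+ m * (k * (2 * M * s)) = k ^+ m.+1 * B.
    rewrite /B !exprMn /s (exprS k) (exprSr e m.+1) (exprSr e m).
    by set km := k ^+ m; set Mm := M ^+ m; set em := e ^+ m; set fm := 4 ^+ m;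
      ring.
  have -> : (2 * mu) ^+ m.+1 * (4 * M) ^+ m * (2 * M) * e ^+ m.+2 = (2 * mu) ^+
    m.+1 * B.
    by rewrite /B !mulrA.
  apply: ler_wpM2r => //; apply: lerXn2r; rewrite ?nnegrE ?(ltW k0)//.
    by rewrite mulr_ge0// ltW.
  by rewrite kE mulrC ler_pM2r//; lra.
move=> z zK; have [zB|zB] := pselect (lp_ball q m.+1 z); [by left|right].
have pE := polar_lp_ball p q m.+1 p0 q0 pq.
rewrite -pE in zK.
(* A functional separating [z] from the polar ball exceeds 1 at [y] too, so [x] is close to the
   contact point. *)
have [x xB xz] : exists2 x, lp_ball p m.+1 x & 1 < dotmul x z.
  move: zB; rewrite -pE /polar/= => /existsNP[x] /not_implyP[xB /negP].
  by rewrite -ltNge => xz; exists x.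
have zmax x' : lp_ball p m.+1 x' -> dotmul x' z <= Num.max 1 (dotmul x' y).
  by move=> x'B; exact: conv_hull_polar_le zK x'B.
have xy : 1 < dotmul x y.
  by have := lt_le_trans xz (zmax x xB); rewrite lt_max ltxx.
have [xi xE] : {xi | forall i, x 0 i = nu * (1 + xi i)}.
  by exists (fun i => x 0 i / nu - 1) => i; field; rewrite gt_eqF.
have [zeta zE] : {zeta | forall i, z 0 i = k * (1 + zeta i)}.
  by exists (fun i => z 0 i / k - 1) => i; field; rewrite gt_eqF.
have cst (a : R) : \sum_(i < m.+1) a = n * a
  by rewrite sumr_const card_ord mulr_natl.
have h1 : p * (\sum_i xi i) + c * (\sum_i xi i ^+ 2) <= 0.
  rewrite -(lerD2l n) addr0 addrA.
  have -> : n + p * (\sum_i xi i) + c * (\sum_i xi i ^+ 2) =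
      \sum_i (1 + p * ((1 + xi i) - 1) + c * ((1 + xi i) - 1) ^+ 2).
    rewrite !big_split/= cst mulr1 !mulr_sumr; congr (_ + _ + _);
      apply: eq_bigr => i _; ring.
  apply: (@le_trans _ _ (\sum_i `|1 + xi i| `^ p)).
    apply: ler_sum => i _; apply: powR_ge_quadratic => //.
      by rewrite invf_ge1.
    have -> : 1 + xi i = x 0 i * nu^-1
      by rewrite xE mulrAC mulfV ?mul1r ?gt_eqF.
    rewrite normrM (gtr0_norm nuV0) ler_piMl ?(ltW nuV0)//.
    exact: norm_lp_ball xB.
  rewrite -[leRHS]mulr1 -ler_pdivrMl// mulr_sumr -nup.
  apply: le_trans xB; rewrite le_eqVlt; apply/orP; left;
    apply/eqP/eq_bigr => i _.
  by rewrite xE normrM (gtr0_norm nu0) powRM// ltW.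
have nuk : nu * k = (1 + s) / n by rewrite kE mulrA numu mulrC.
have xy' : 1 < (1 + s) * (1 + (\sum_i xi i) / n).
  move: xy; rewrite dotmul_const; under eq_bigr do rewrite xE.
  rewrite -mulr_sumr mulrA (mulrC k) nuk big_split/= cst mulr1.
  congr (_ < _); field; rewrite gt_eqF//.
have xz' : 1 < (1 + s) * (1 + (\sum_i xi i + \sum_i zeta i + \sum_i xi i * zeta
  i) / n).
  move: xz; rewrite /dotmul.
  have E i : x 0 i * z 0 i = (1 + s) / n * (1 + xi i + zeta i + xi i * zeta i).
    by rewrite xE zE -nuk; ring.
  under eq_bigr do rewrite E.
  rewrite -mulr_sumr !big_split/= cst mulr1.
  congr (_ < _); field; rewrite gt_eqF//.
(* Every x' in the l_p ball pairs with [y] to at most 1 + s, hence also with [z]; so z / (1+s) lies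
   in the l_q ball, and [powR_norm_ge_square] is summed over its coordinates. *)
have h4 : 2 * (\sum_i zeta i) + \sum_i zeta i ^+ 2 <= 0.
  have wB : lp_ball q m.+1 ((1 + s)^-1 *: z).
    rewrite -pE => x' x'B; rewrite dotmulZr ler_pdivrMl ?mulr1; last lra.
    apply: le_trans (zmax x' x'B) _; rewrite ge_max; apply/andP; split;
      first lra.
    have mB : lp_ball q m.+1 (const_mx mu).
      rewrite /lp_ball/=; under eq_bigr do rewrite mxE gtr0_norm// muq.
      by rewrite cst mulfV// gt_eqF.
    have := mB; rewrite -pE => /(_ x' x'B).
    rewrite /y !dotmul_const kE (mulrC mu (1 + s)) -mulrA => H.
    rewrite ler_piMr//; lra.
  have : \sum_(i < m.+1) `|1 + zeta i| `^ q <= n.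
    rewrite -[leRHS]mulr1 -ler_pdivrMl// mulr_sumr -muq.
    apply: le_trans wB; rewrite le_eqVlt; apply/orP; left;
      apply/eqP/eq_bigr => i _.
    rewrite mxE zE kE (_ : (1 + s)^-1 * _ = mu * (1 + zeta i)); last first.
      by field; rewrite gt_eqF//; lra.
    by rewrite normrM (gtr0_norm mu0) powRM// ltW.
  move=> H.
  have : \sum_(i < m.+1) (1 + q / 2 * (2 * zeta i + zeta i ^+ 2)) <= n.
    apply: le_trans H; apply: ler_sum => i _.
    have -> : 2 * zeta i + zeta i ^+ 2 = (1 + zeta i) ^+ 2 - 1 by ring.
    exact: powR_norm_ge_square.
  rewrite big_split/= cst mulr1 gerDl -mulr_sumr pmulr_rle0; last lra.
  by rewrite big_split/= -mulr_sumr.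
have nsE a : 1 < (1 + s) * (1 + a / n) -> - (n * s) <= a.
  move=> H; rewrite leNgt; apply/negP => an.
  have : a / n < - s by rewrite ltr_pdivrMr//; lra.
  move: H; move: (a / n) => w H ws.
  have : (1 + s) * (1 + w) < (1 + s) * (1 - s) by rewrite ltr_pM2l; lra.
  have := sqr_ge0 s; rewrite expr2; lra.
have := near_contact_estimate _ xi zeta p c s p0 c0 h1 (nsE _ xy') (nsE _ xz')
  h4.
rewrite /= -/n -ME => -[Z4 /andP[bl b0]].
have zl i : `|zeta i| <= 2 * M * e.
  have Me : 0 <= 2 * M * e by rewrite !mulr_ge0 ?(ltW M0) ?(ltW e0).
  rewrite -ler_sqr ?nnegrE// real_normK ?num_real//.
  apply: (@le_trans _ _ (\sum_i zeta i ^+ 2)).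
    by rewrite (bigD1 i)//= lerDl; apply: sumr_ge0 => j _; exact: sqr_ge0.
  apply: le_trans Z4 _; rewrite !exprMn -/s ler_pM2r//.
  by rewrite (_ : 2 ^+ 2 = 4) ?ler_pM2l// ?ler_eXnr//; ring.
split=> [i|].
  have := zl (widen_ord (leqnSn m) i); rewrite ler_norml /r zE => /andP[? ?].
  by apply/andP; split; [rewrite ler_pM2l//; lra|rewrite -mulrDr ler_pM2l//;
    lra].
under eq_bigr do rewrite zE.
rewrite -mulr_sumr big_split/= cst mulr1 /h.
by apply/andP; split; [rewrite ler_pM2l//; lra|rewrite -mulrDr ler_pM2l//; lra].
Qed.

End illumination_body_diag.

(** * Illumination body of the l_q ball beyond a vertex *)

Section illumination_body_vertex.
Context {R : realType}.
Local Notation RT := (measurableTypeR R).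

(* A skew prism: the slice at height z_0 is a cube whose centre moves affinely
   with z_0, so that sections of a cone with off-axis apex fit. *)
Definition skew_box m (y : 'I_m -> R) (a d h c : R) : set 'rV[R]_m.+1 :=
  [set z | 1 < z 0 ord0 <= 1 + h /\
    forall i : 'I_m, `|z 0 (lift ord0 i) - (a * z 0 ord0 + d) * y i| <= c].

Lemma vol_skew_box m (y : 'I_m -> R) (a d h c : R) : 0 < h -> 0 < c ->
  vol (skew_box m y a d h c) = (h * (2 * c) ^+ m)%:E.
Proof.
move=> h0 c0; rewrite /vol /skew_box.
rewrite (@lebesgue_tuple_cst_sections _ _ _ `]1, 1 + h]%classic
  ((2 * c) ^+ m)%:E)//.
- rewrite lebesgue_measure_itv/= lte_fin ltrDl h0 -EFinB -EFinM; congr EFin;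
  ring.
- move=> x; rewrite /= in_itv/= => xh.
  pose B (i : 'I_m) : set RT :=
    `[(a * x + d) * y i - c, (a * x + d) * y i + c]%classic.
  rewrite [LHS](_ : _ = lebesgue_tuple [set t : m.-tuple RT | forall i,
    B i (tnth t i)]).
    rewrite lebesgue_tuple_box => [|i]; last exact: measurable_itv.
    rewrite (eq_bigr (fun=> (2 * c)%:E)) ?prodEFin ?prodr_const ?card_ord// =>
      i _.
    rewrite /B lebesgue_measure_itv/= lte_fin -EFinB.
    by case: ltP => h1; congr EFin; lra.
  congr lebesgue_tuple; apply/seteqP; split=> t /=; rewrite mxE tnth0.
    move=> [_ H] i; rewrite /B/= in_itv/=; have := H i.
    by rewrite mxE tnthS ler_distl.
  move=> H; split=> // i; have := H i; rewrite /B/= in_itv/=.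
  by rewrite mxE tnthS ler_distl.
- by move=> x t /= [+ _]; rewrite mxE tnth0 in_itv.
Qed.

Lemma measurable_skew_box m (y : 'I_m -> R) (a d h c : R) :
  measurable_rv m.+1 (skew_box m y a d h c).
Proof.
rewrite /measurable_rv /skew_box.
pose f (i : 'I_m) (t : m.+1.-tuple RT) : R :=
  tnth t (lift ord0 i) - (a * tnth t ord0 + d) * y i.
have mf i : measurable_fun setT (f i).
  apply: measurable_funB; first exact: measurable_tnth.
  apply: measurable_funM => //; apply: measurable_funD => //.
  by apply: measurable_funM => //; exact: measurable_tnth.
rewrite (_ : mkset _ =
  ((fun t : m.+1.-tuple RT => tnth t ord0) @^-1` `]1, 1 + h]%classic) `&`
  \bigcap_(i in [set: 'I_m]) (f i @^-1` `[- c, c]%classic)).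
  apply: measurableI.
    rewrite -[X in measurable X]setTI.
    exact: (@measurable_tnth _ RT _ ord0 measurableT _ (measurable_itv _)).
  apply: fin_bigcap_measurable => // i _.
  by rewrite -[X in measurable X]setTI; apply: mf => //; exact: measurable_itv.
apply/seteqP; split=> t /=; rewrite mxE in_itv/= => -[t0 H]; split=> // i.
  by move=> _; rewrite /f/= in_itv/= -ler_norml; have := H i; rewrite !mxE.
by have := H i I; rewrite /f/= in_itv/= -ler_norml !mxE.
Qed.

(** The hull contains, above height 1 and thus outside the ball, a prism of height s/2 and half-side
    of order s^(1/q); its volume is of order s^(1+m/q). *)
Lemma illumination_body_lp_vertex (q : R) m : 1 < q ->
  {A : R | 0 < A & forall s delta' (y : 'rV[R]_m.+1), 0 < s -> s <= 1 ->
    illumination_body (lp_ball q m.+1) delta' y -> 1 + s <= y 0 ord0 ->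
    A * s `^ (1 + m%:R / q) <= delta'}.
Proof.
move=> q1; have q0 : 0 < q by lra.
set n : R := m.+1%:R.
have n0 : 0 < n by rewrite ltr0n.
have mn : m%:R = n - 1 by rewrite /n -natr1 addrK.
have [v v0 vE] := vol_lp_ballE q m.+1 q0.
exists (1 / 2 * (n^-1 `^ q^-1 / 2) ^+ m / v).
  by rewrite divr_gt0// mulr_gt0// exprn_gt0// divr_gt0// powR_gt0// invr_gt0.
move=> s delta' y s0 s1 yE ys.
(* At height 1 - s the cube of half-side [rho] fits in the ball: |1-s|^q <= 1 - s, and the other m
   coordinates add at most m s / n < s. *)
have [rho rhoE] : {rho | rho = (s / n) `^ q^-1} by exists ((s / n) `^ q^-1).
have rho0 : 0 < rho by rewrite rhoE powR_gt0// divr_gt0.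
(* The height of [y] above the slice at 1 - s. The axis of [P] joins (1-s) e_1 to [y]. *)
pose D := y 0 ord0 - 1 + s.
have D0 : 0 < D by rewrite /D; lra.
pose P := skew_box m (fun i =>
  y 0 (lift ord0 i)) D^-1 (- ((1 - s) / D)) (s / 2) (rho / 4).
have sub : lp_ball q m.+1 `|` P `<=` conv_hull (lp_ball q m.+1 `|` [set y]).
  move=> z [zB|[/andP[z1 zs] Pz]].
    by move=> B [_ AB]; apply: AB; left.
  (* The weight for which z = l k + (1-l) y with [k] at height 1 - s. The prism height s/2 forces l
     >= 1/4, so the half-side rho/4 keeps [k] in the cube of half-side [rho]. *)
  pose l := (y 0 ord0 - z 0 ord0) / D.
  have l4 : 1 / 4 <= l by rewrite /l ler_pdivlMr// /D; lra.
  have l1 : l <= 1 by rewrite /l ler_pdivrMr// /D; lra.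
  have l0 : 0 < l by lra.
  have lE : D^-1 * z 0 ord0 - (1 - s) / D = 1 - l.
    have : D * D^-1 = 1 by rewrite mulfV ?gt_eqF.
    by rewrite /l; set w := D^-1 => DD; rewrite -[X in _ = X - _]DD /D; ring.
  pose k := l^-1 *: (z - (1 - l) *: y).
  have -> : z = l *: k + (1 - l) *: y.
    by rewrite /k scalerA mulfV ?gt_eqF// scale1r subrK.
  apply: conv_hull_segment; [left|by right|exact: ltW|by []].
  rewrite /lp_ball/= big_ord_recl.
  have -> : k 0 ord0 = 1 - s.
    have -> : k 0 ord0 = l^-1 * (z 0 ord0 - (1 - l) * y 0 ord0)
      by rewrite /k !mxE.
    have -> : z 0 ord0 = y 0 ord0 - l * D by rewrite /l divfK ?gt_eqF//; ring.
    have -> : y 0 ord0 - l * D - (1 - l) * y 0 ord0 = l * (y 0 ord0 - D)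
      by ring.
    by rewrite mulKf ?gt_eqF// /D; ring.
  have k1 : `|1 - s| `^ q <= 1 - s.
    rewrite ger0_norm ?subr_ge0//.
    have : 0 <= 1 - s by rewrite subr_ge0.
    rewrite le_eqVlt => /predU1P[<-|s10]; first by rewrite powR0// gt_eqF.
    by apply: ge1r_powR; [rewrite s10/=; lra|exact: ltW].
  have k2 : \sum_(i < m) `|k 0 (lift ord0 i)| `^ q <= m%:R * (s / n).
    rewrite mulr_natl -[X in _ *+ X]card_ord -sumr_const; apply: ler_sum => i _.
    have -> : s / n = rho `^ q
      by rewrite rhoE -powRrM mulVf ?gt_eqF// powRr1// ltW// divr_gt0.
    apply: ge0_ler_powR; rewrite ?nnegrE ?(ltW q0) ?(ltW rho0)//.
    have := Pz i; rewrite lE => Pzi.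
    rewrite !mxE normrM gtr0_norm ?invr_gt0// ler_pdivrMl//.
    by apply: le_trans Pzi _; nra.
  apply: le_trans (lerD k1 k2) _; rewrite mn.
  have : s / n <= s by rewrite ler_pdivrMr// ler_peMr// ?(ltW s0)// ler1n.
  have -> : (n - 1) * (s / n) = s - s / n by field; rewrite gt_eqF.
  have : 0 < s / n by rewrite divr_gt0.
  by move: (s / n) => w; lra.
have := le_trans (le_vol _ _ _ sub) yE.
rewrite vol_setU; last 3 first.
- exact: (measurable_lp_sublevel q m.+1 1).
- exact: measurable_skew_box.
- move=> z [zB [/andP[z1 _] _]].
  have := norm_lp_ball q _ z ord0 q0 zB; rewrite leNgt => /negP; apply.
  by apply: lt_le_trans z1 (ler_norm _).
rewrite vE /P vol_skew_box ?divr_gt0// -EFinD -EFinM lee_fin [(1 + _) *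
  v]mulrDl [1 * v]mul1r lerD2l => H.
rewrite -(ler_pM2r v0); apply: le_trans H; rewrite le_eqVlt; apply/orP; left;
  apply/eqP.
rewrite rhoE powRM ?(ltW s0) ?invr_ge0 ?(ltW n0)//.
rewrite powRD ?(gt_eqF s0) ?implybT// powRr1 ?(ltW s0)//.
have -> : s `^ (m%:R / q) = (s `^ q^-1) ^+ m
  by rewrite -powR_mulrn ?powR_ge0// -powRrM mulrC.
have -> : 2 * (s `^ q^-1 * n^-1 `^ q^-1 / 4) = s `^ q^-1 * (n^-1 `^ q^-1 / 2)
  by field.
rewrite (exprMn m (s `^ q^-1)).
move: ((s `^ q^-1) ^+ m) ((n^-1 `^ q^-1 / 2) ^+ m) => X Y.
by field; rewrite gt_eqF.
Qed.

End illumination_body_vertex.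

(** * Lower bound for the distance at a given cap depth *)

Lemma powR_absorb (R : realType) (a b C : R) : a < b -> 0 < C ->
  {t0 : R | 0 < t0 & forall t, 0 < t -> t < t0 -> C * t `^ b < t `^ a}.
Proof.
move=> ab C0; have g0 : 0 < b - a by rewrite subr_gt0.
exists (C^-1 `^ (b - a)^-1); first by rewrite powR_gt0// invr_gt0.
move=> t t_gt0 tt0.
have -> : t `^ b = t `^ (b - a) * t `^ a.
  by rewrite -powRD ?(gt_eqF t_gt0) ?implybT// subrK.
rewrite mulrA gtr_pMl ?powR_gt0// -ltr_pdivlMl// mulr1.
have := @gt0_ltr_powR R (b - a) g0 t _ _ _ tt0;
  rewrite !nnegrE powR_ge0 (ltW t_gt0).
by rewrite -powRrM mulVf ?gt_eqF// powRr1 ?invr_ge0 ?(ltW C0)//; apply.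
Qed.

Section float_illum_dist_lp.
Context {R : realType}.

(** The parameter is the cap depth [t]; the equation makes the bound of [vol_lp_cap_le] at depth [t]
    equal to delta |C|. *)
Lemma float_illum_dist_lp_ge (p : R) m (eps : R) :
  1 < p -> p < 2 -> (0 < m)%N -> 0 < eps -> eps <= 1 ->
  {t0 : R | 0 < t0 & forall t delta, 0 < t -> t < t0 ->
    (delta%:E * vol (lp_ball p m.+1) =
      ((p * t) `^ (m%:R / p + 1) / (m%:R + p))%:E * vol (lp_ball p m))%E ->
    ((1 + (1 - eps) * t)%:E <= float_illum_dist (lp_ball p m.+1) delta)%E}.
Proof.
move=> p1 p2 m0 eps0 eps1.
have p0 : 0 < p by lra.
have [q qE] : {q | q = p / (p - 1)} by exists (p / (p - 1)).
have q2 : 2 < q by rewrite qE ltr_pdivlMr; lra.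
have q0 : 0 < q by lra.
have pq : p^-1 + q^-1 = 1.
  by rewrite qE; field; rewrite !gt_eqF//; lra.
set n : R := m.+1%:R.
have n0 : 0 < n by rewrite ltr0n.
have [mu muE] : {mu | mu = n^-1 `^ q^-1} by exists (n^-1 `^ q^-1).
have [nu nuE] : {nu | nu = n^-1 `^ p^-1} by exists (n^-1 `^ p^-1).
have nV0 : 0 < n^-1 by rewrite invr_gt0.
have mu0 : 0 < mu by rewrite muE powR_gt0.
have nu0 : 0 < nu by rewrite nuE powR_gt0.
have muq : mu `^ q = n^-1 by rewrite muE -powRrM mulVf ?gt_eqF// powRr1// ltW.
have nup : nu `^ p = n^-1 by rewrite nuE -powRrM mulVf ?gt_eqF// powRr1// ltW.
have numu : nu * mu = n^-1.
  by rewrite muE nuE -powRD ?(gt_eqF nV0) ?implybT// pq powRr1// ltW.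
have [A2 A20 diag] := illumination_body_lp_diag p q m mu p1 p2 q2 pq mu0 muq.
have [A3 A30 vertex] := illumination_body_lp_vertex q m ltac:(lra).
have [vn vn0 vnE] := vol_lp_ballE p m.+1 p0.
have [vm vm0 vmE] := vol_lp_ballE p m p0.
have mR : 0 < m%:R :> R by rewrite ltr0n.
(* As p < 2 < q, the diagonal exponent [h] lies strictly between 1 + m/q, for the vertex of the
   polar, and k + 1 = 1 + m/p, for the cap of C. Both comparisons then follow from [powR_absorb]. *)
pose k := m%:R / p; pose h : R := m%:R / 2 + 1.
have hk : h < k + 1 by rewrite ltrD2r ltr_pM2l// ltf_pV2 ?posrE.
have hl : 1 + m%:R / q < h by rewrite /h addrC ltrD2r ltr_pM2l// ltf_pV2 ?posrE.
pose B1 := (nu / (2 * n)) ^+ m * nu.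
have B10 : 0 < B1 by rewrite mulr_gt0// exprn_gt0// divr_gt0// mulr_gt0.
pose K := p `^ (k + 1) / (m%:R + p) * vm.
have mp0 : 0 < m%:R + p by rewrite addr_gt0.
have K0 : 0 < K by apply: mulr_gt0 => //; apply: divr_gt0 => //;
  exact: powR_gt0.
pose L := A3 * eps `^ (1 + m%:R / q).
have L0 : 0 < L by rewrite mulr_gt0// powR_gt0.
pose N := A2 * 3 `^ h.
have N0 : 0 < N by rewrite mulr_gt0// powR_gt0.
have [t1 t10 Ht1] := powR_absorb _ _ _ (K / B1) hk (divr_gt0 K0 B10).
have [t2 t20 Ht2] := powR_absorb _ _ _ (N / L) hl (divr_gt0 N0 L0).
have t30 : 0 < ((2 * n)^-1) ^+ 2 by rewrite exprn_gt0// invr_gt0 mulr_gt0.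
(* [t1] makes delta |C| smaller than the sheared box on the diagonal; [t2] makes the vertex cost at
   eps t exceed the diagonal cost at 3t; the last two give sqrt t <= 1/(2n) and sqrt(3t) <= 1. *)
exists (Num.min (Num.min t1 t2) (Num.min ((2 * n)^-1 ^+ 2) 3^-1)).
  by rewrite !lt_min t10 t20 t30/= invr_gt0.
move=> t delta t_gt0; rewrite !lt_min => /andP[/andP[tt1 tt2] /andP[tt3 tt4]].
have sqrtE x : 0 <= x -> Num.sqrt x ^+ m.+2 = x `^ h.
  move=> x0; rewrite -powR12_sqrt// -powR_mulrn ?powR_ge0// -powRrM; congr powR.
  by rewrite /h -natr1 -natr1; field.
rewrite vnE vmE -!EFinM => -[deltaE].
have {}deltaE : delta * vn = K * t `^ (k + 1).
  rewrite deltaE /K powRM ?(ltW p0) ?(ltW t_gt0)//; ring.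
apply: le_ereal_inf_tmp => _ [delta' /= delta'0 <-].
apply: le_ereal_inf_tmp => _ [a [a1 sub1 sub2] <-].
rewrite lee_fin.
have pE := polar_lp_ball p q m.+1 p0 q0 pq.
have a0 : 0 < a by lra.
(* The factor 3 suffices on the diagonal: (1-t)(1+3t) = 1 + 2t - 3t^2 >= 1 + t for t <= 1/3. *)
have [big|small] := leP (A2 * Num.sqrt (3 * t) ^+ m.+2) delta'.
  have x0C : floating_body (lp_ball p m.+1) delta (const_mx (nu * (1 - t))).
    have e0 : 0 < Num.sqrt t by rewrite sqrtr_gt0.
    have {1}-> : t = Num.sqrt t ^+ 2 by rewrite sqr_sqrtr// ltW.
    apply: floating_body_lp_diag => //.
      have w0 : 0 <= (2 * n)^-1 by rewrite invr_ge0 mulr_ge0// ltW.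
      by rewrite -/n -[leRHS](ger0_norm w0) -sqrtr_sqr ler_wsqrtr// ltW.
    rewrite vnE -EFinM lte_fin deltaE -/n.
    have -> : (nu * Num.sqrt t / (2 * n)) ^+ m * (nu * Num.sqrt t ^+ 2) = B1 *
      t `^ h.
      rewrite (_ : nu * _ / _ = nu / (2 * n) * Num.sqrt t); last by field;
        rewrite gt_eqF.
      rewrite exprMn -sqrtE ?(ltW t_gt0)// /B1 -(addn2 m) exprD.
      by move: ((nu / (2 * n)) ^+ m) (Num.sqrt t ^+ m) => X Y; ring.
    by rewrite -ltr_pdivrMl// mulrA (mulrC _ K) Ht1.
  have s0 : 0 < Num.sqrt (3 * t) by rewrite sqrtr_gt0 mulr_gt0.
  have s1 : Num.sqrt (3 * t) <= 1 by rewrite -[leRHS]sqrtr1 ler_wsqrtr//; lra.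
  have := diag _ _ s0 s1 big; rewrite sqr_sqrtr; last lra.
  move=> y0I.
  have x0D : dilate a^-1 (floating_body (lp_ball p m.+1) delta) (a^-1 *:
    const_mx (nu * (1 - t))).
    by exists (const_mx (nu * (1 - t))).
  have := sub1 _ x0D _ y0I; rewrite dotmulZr dotmul_const.
  under eq_bigr do rewrite mxE.
  rewrite sumr_const card_ord -[X in _ * (_ * X)]mulr_natl -/n ler_pdivrMl//
    mulr1.
  have -> : nu * (1 - t) * (n * (mu * (1 + 3 * t))) = (nu * mu) * n * ((1 - t)
    * (1 + 3 * t)) by ring.
  rewrite numu mulVf ?gt_eqF// mul1r; apply: le_trans.
  have : t * t <= t * 3^-1 by rewrite ler_pM2l// ltW.
  have : 0 < eps * t by rewrite mulr_gt0.
  lra.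
have y1 y : illumination_body (polar (lp_ball p m.+1)) delta' y ->
  y 0 ord0 <= 1 + eps * t.
  rewrite pE => yI; rewrite leNgt; apply/negP => yt.
  have et0 : 0 < eps * t by rewrite mulr_gt0.
  have et1 : eps * t <= 1 by rewrite mulr_ile1// ?ltW//; lra.
  have := le_lt_trans (vertex (eps * t) delta' y et0 et1 yI (ltW yt)) small.
  rewrite sqrtE ?mulr_ge0 ?(ltW t_gt0)// !powRM ?(ltW eps0) ?(ltW t_gt0)//
    !mulrA -/L -/N.
  have := Ht2 t t_gt0 tt2; rewrite mulrAC ltr_pdivrMr// mulrC => H1 H2.
  by have := lt_trans H2 H1; rewrite mulrC ltxx.
have et : 0 < 1 + eps * t by rewrite addr_gt0// mulr_gt0.
have /sub2[x xC /rowP/(_ ord0)] : polar_illumination_body (lp_ball p m.+1)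
  delta' ((1 + eps * t)^-1 *: delta_mx 0 ord0).
  move=> y /y1 y1t; rewrite dotmulZr dotmulC dotmul_delta.
  by rewrite ler_pdivrMl// mulr1.
rewrite !mxE !eqxx mulr1 => ax.
have xt : x 0 ord0 <= 1 - t.
  apply: (floating_body_lp_le p m t delta) xC => //.
    by rewrite t_gt0; lra.
  rewrite vnE vmE -!EFinM lee_fin deltaE /K powRM ?(ltW p0) ?(ltW t_gt0)//.
  by rewrite le_eqVlt; apply/orP; left; apply/eqP; rewrite /k; ring.
have : a * x 0 ord0 <= a * (1 - t) by rewrite ler_pM2l.
rewrite ax -(ler_pM2r et) mulVf ?gt_eqF// => H.
(* Since (1-t)(1 + eps t) <= 1 - w, the inclusions give a (1-w) >= 1, and (1+w)(1-w) <= 1 turns this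
   into a >= 1 + w. *)
pose w := (1 - eps) * t.
have w0 : 0 <= w by rewrite mulr_ge0 ?subr_ge0// ltW.
have w1 : 0 < 1 - w.
  have : w <= t by rewrite ler_piMl ?(ltW t_gt0)//; lra.
  lra.
have H1 : 1 <= a * (1 - w).
  apply: (le_trans H); rewrite -mulrA ler_pM2l//.
  have := mulr_ge0 (ltW eps0) (sqr_ge0 t); rewrite /w; lra.
rewrite leNgt; apply/negP; rewrite -/w -(ltr_pM2r w1) => aw.
have := sqr_ge0 w; have := le_lt_trans H1 aw; lra.
Qed.

End float_illum_dist_lp.

(** * Passage to the lower limit *)

Theorem proposition4p12 (R : realType) (n : nat) (p : R)
    (hn : (2 <= n)%N) (hp1 : 1 < p) (hp2 : p < 2) :
  let alpha := p / (n%:R - 1 + p) in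
  (((n%:R - 1 + p) `^ alpha / p
      * (fine (vol (lp_ball p n)) / fine (vol (lp_ball p n.-1))) `^ alpha)%:E
   <= limf_einf
        (fun delta : R => (float_illum_dist (lp_ball p n) delta - 1)
                            / (delta `^ alpha)%:E)
        (0 : R)^'+)%E.
Proof.
case: n hn => [//|m] hm; rewrite ltnS in hm.
have p0 : 0 < p by lra.
have -> : m.+1%:R - 1 = m%:R :> R by rewrite -natr1 addrK.
cbv zeta; set alpha := p / (m%:R + p); rewrite -[m.+1.-1]/m.
have [vn vn0 vnE] := vol_lp_ballE p m.+1 p0.
have [vm vm0 vmE] := vol_lp_ballE p m p0.
have m1 : 0 < m%:R :> R by rewrite ltr0n.
have mp0 : 0 < m%:R + p by rewrite addr_gt0.
have alpha0 : 0 < alpha by rewrite divr_gt0.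
have kE : m%:R / p + 1 = alpha^-1 by rewrite /alpha; field; rewrite !gt_eqF.
have [c cE] : {c | c = (m%:R + p) `^ alpha / p * (vn / vm) `^ alpha}.
  by exists ((m%:R + p) `^ alpha / p * (vn / vm) `^ alpha).
have c0 : 0 < c.
  by rewrite cE; apply: mulr_gt0; [apply: divr_gt0|] => //;
    apply: powR_gt0 => //; exact: divr_gt0.
rewrite [X in (X%:E <= _)%E](_ : _ = c); last by rewrite cE vnE vmE.
rewrite limf_einfE; apply/lee_subgt0Pr => eta eta0.
(* Chosen so that (1 - eps) c >= c - eta. *)
pose eps := Num.min 1 (eta / c).
have eps0 : 0 < eps by rewrite lt_min ltr01 divr_gt0.
have eps1 : eps <= 1 by rewrite ge_min lexx.
have epsc : eps * c <= eta by rewrite -ler_pdivlMr// ge_min lexx orbT.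
have [t0 t00 Ht] := float_illum_dist_lp_ge p m eps hp1 hp2 hm eps0 eps1.
pose d0 := (t0 / c) `^ alpha^-1.
have d00 : 0 < d0 by rewrite powR_gt0// divr_gt0.
apply: le_trans; last first.
  apply: ereal_sup_ubound.
  by exists [set d : R | 0 < d /\ d < d0] => //; apply: filterI;
    [exact: nbhs_right_gt|exact: nbhs_right_lt].
apply: le_ereal_inf_tmp => _ [d [d_gt0 dd0] <-].
have da0 : 0 < d `^ alpha by rewrite powR_gt0.
rewrite inver gt_eqF// lee_pdivlMr// leeBrDl// -EFinB -EFinM -EFinD.
apply: le_trans (Ht (c * d `^ alpha) d _ _ _); last first.
- rewrite vnE vmE kE -!EFinM; congr EFin.
  (* This is what fixes the constant [c]: at depth t = c d^alpha, raising p t to the power 1/alpha =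
     m/p + 1 gives (m+p)(vn/vm) d, the required equality of volumes. *)
  have -> : p * (c * d `^ alpha) = ((m%:R + p) * (vn / vm) * d) `^ alpha.
    have vv : 0 <= vn / vm by rewrite divr_ge0// ltW.
    rewrite (powRM _ (mulr_ge0 (ltW mp0) vv) (ltW d_gt0)) (powRM _ (ltW mp0)
      vv) cE.
    by field; rewrite gt_eqF.
  rewrite -powRrM mulfV ?gt_eqF// powRr1; last first.
    by rewrite !mulr_ge0 ?invr_ge0 ?(ltW mp0) ?(ltW d_gt0) ?(ltW vn0) ?(ltW
      vm0).
  by field; rewrite !gt_eqF.
- rewrite -ltr_pdivlMl// mulrC.
  have := @gt0_ltr_powR R alpha alpha0 d d0;
    rewrite !nnegrE (ltW d_gt0) (ltW d00).
  move=> /(_ erefl erefl dd0); rewrite /d0 -powRrM mulVf ?gt_eqF// powRr1//.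
  by rewrite divr_ge0// ltW.
- by rewrite mulr_gt0.
- by rewrite lee_fin lerD2l mulrA ler_pM2r// mulrBl mul1r lerD2l lerN2.
Qed.
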